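(* Given $N\ge2$ locations $(X_1,Y_1),\dots,(X_N,Y_N)$ in $\mathbf{R}^2$, each with a label in $\{0,1\}$, the following algorithm, which enumerates a set of approximating rectangles and computes the local test statistic $T$ on each of them, runs in $O(N\log^4N)$ time. Algorithm: Sort the locations $(X_1,Y_1),\dots,(X_N,Y_N)$ according to the $X$-value. For $\ell=3,\dots,\lfloor\log_2\frac N{2\log N}\rfloor$ do: - Set $s:=2^{-\ell}$, $\varepsilon:=\ell^{-1/2}/6$. - For $i=0,\dots,\ell$, for $j=0,\dots,\lfloor(\varepsilon s2^i)^{-1}\rfloor$, for $k=j+1,\dots,j+\lfloor1/\varepsilon\rfloor$ (nested loops) do: - Extract all locations $(X_p,Y_p)$ for which $X_p$ falls in the interval $\mathcal{X}_{jk}:=[X_{(j\varepsilon s2^iN+1)},X_{(k\varepsilon s2^iN)}]$ and denote by $N_{jk}$ the number of these locations. - Sort these extracted $Y_p$ and compute the vector of cumulative sums of the labels of the $(X_p,Y_p)$ corresponding to the sorted $Y_p$. - For $m=0,\dots,\lfloor2^i/\varepsilon\rfloor$, for $n=m+1,\dots,m+\lfloor2/\varepsilon\rfloor$ (nested loops) do: compute the test statistic $T$ on the rectangle $\mathcal{X}_{jk}\times[Y_{(m\varepsilon2^{-i}N_{jk}+1)},Y_{(n\varepsilon2^{-i}N_{jk})}]$, where the order statistics $Y_{(\cdot)}$ are with respect to the extracted $Y_p$.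
   Context: Running time is the number of elementary steps (arithmetic operations, logarithm evaluations, comparisons and memory accesses at unit cost); sorting $M$ numbers takes $O(M\log M)$ steps. The implied constant in $O(N\log^4N)$ is universal; $\log$ is the natural logarithm. $X_{(1)}\le\dots\le X_{(N)}$ are the order statistics of $X_1,\dots,X_N$, and for real $r$, $X_{(r)}:=X_{(\mathrm{round}(r)\wedge N)}$; the same notation is used for the order statistics of the extracted $Y_p$ (with $N$ replaced by $N_{jk}$); an interval whose right index is smaller than its left index is empty. The locations are a sample from a continuous distribution, so that the coordinates are distinct. The test statistic on a rectangle $R$ containing $n_R$ locations is $$T(R)=n_R\Bigl(\hat p\log\tfrac{\hat p}{\overline p}+(1-\hat p)\log\tfrac{1-\hat p}{1-\overline p}\Bigr)+(N-n_R)\Bigl(\hat q\log\tfrac{\hat q}{\overline p}+(1-\hat q)\log\tfrac{1-\hat q}{1-\overline p}\Bigr)$$ if $\hat q\le\hat p$ and $T(R)=0$ otherwise, where $\overline p$ is the overall proportion of labels equal to 1 and $\hat p,\hat q$ are the proportions of labels equal to 1 in $R$ and in $R^c$ ($0\log0=0$; $T(R)=0$ if $n_R\in\{0,N\}$ or $\overline p\in\{0,1\}$). In the innermost loop, with $a=m\varepsilon2^{-i}N_{jk}+1$ and $b=n\varepsilon2^{-i}N_{jk}$, the number of locations in the rectangle is obtained from the (rounded) indices as $\mathrm{round}(b)-\mathrm{round}(a)+1$, and the number of labels equal to 1 in it as the cumulative-sum vector at index $\mathrm{round}(b)$ minus that at index $\mathrm{round}(a-1)$ (indices truncated at $N_{jk}$,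 counts of empty intervals being $0$).
   Formalization: When round(a) = N_jk+1, the label count is the cumulative sum at round(b) truncated at N_jk minus that at index N_jk−1 (truncate before subtracting 1), not at round(a−1) truncated, so that it is the true label count of the one-point rectangle. *)

(* Defs.v *)
From HB Require Import structures.
From mathcomp Require Import all_boot all_order all_algebra.
From mathcomp Require Import reals exp.

Set Implicit Arguments.
Unset Strict Implicit.
Unset Printing Implicit Defensive.

Import Order.TTheory GRing.Theory Num.Theory.

(* A real RAM: programs are syntax, and [exec] gives both their effect and
   their number of elementary steps.  The only control structures are
   conditionals and bounded loops, so that every program terminates.  The same
   program is run for every N and every input. *)

Inductive var : Type :=
  | vN | vK | vell | vs | veps | vi | vw | vj | vk | vla | vra | vM
  | vm | vn | vlb | vrb | vnR | vkR | vpbar | vphat | vqhat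
  | vx1 | vx2 | vx3 | vx4 | vT | vp | vq | vt.

Inductive arr : Type := aX | aY | aB | aP | aE | aF | aQ | aS.

Scheme Boolean Equality for var.
Scheme Boolean Equality for arr.

Inductive unop : Type := Floor | Sqrt | Log.
Inductive binop : Type := Add | Sub | Mul | Div.
Inductive cmpop : Type := Le | Lt | Eq.

Inductive expr : Type :=
  | Lit of nat
  | Var of var
  | Arr of arr & expr
  | Un of unop & expr
  | Bin of binop & expr & expr.

Inductive test : Type := Test of cmpop & expr & expr.

(* [For v lo hi c] runs c with v = lo, lo+1, lo+2, ... as long as v <= hi;
   lo and hi are evaluated once.
   [ArgSort d a n] stores in d[1], ..., d[n] the permutation of 1, ..., n that
   sorts the numbers a[1], ..., a[n] into nondecreasing order.
   [Output e] appends the value of e to the output. *)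
Inductive cmd : Type :=
  | Skip
  | Assign of var & expr
  | Store of arr & expr & expr
  | Seq of cmd & cmd
  | If of test & cmd & cmd
  | For of var & expr & expr & cmd
  | ArgSort of arr & arr & expr
  | Output of expr.

Coercion Lit : nat >-> expr.
Coercion Var : var >-> expr.

Declare Scope prog_scope.
Delimit Scope prog_scope with prog.
Bind Scope prog_scope with expr.
Bind Scope prog_scope with test.
Bind Scope prog_scope with cmd.

Notation "x + y" := (Bin Add x y) : prog_scope.
Notation "x - y" := (Bin Sub x y) : prog_scope.
Notation "x * y" := (Bin Mul x y) : prog_scope.
Notation "x / y" := (Bin Div x y) : prog_scope.
Notation "x <= y" := (Test Le x y) : prog_scope.
Notation "x < y" := (Test Lt x y) : prog_scope.
Notation "x == y" := (Test Eq x y) : prog_scope.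
Notation "a .[ e ]" := (Arr a e) : prog_scope.
Notation "v ::= e" := (Assign v e) (at level 75) : prog_scope.
Notation "c ;; d" := (Seq c d)
  (at level 80, right associativity) : prog_scope.

Section Semantics.
Local Open Scope ring_scope.
Variable R : realType.

Record state : Type := State {
  reg : var -> R;
  mem : arr -> nat -> R;
  out : seq R;
  steps : nat
}.

Definition set_reg (v : var) (x : R) (st : state) : state :=
  State (fun u => if var_beq u v then x else reg st u)
        (mem st) (out st) (steps st).

Definition set_arr (a : arr) (f : nat -> R) (st : state) : state :=
  State (reg st) (fun b => if arr_beq b a then f else mem st b)
        (out st) (steps st).

Definition emit (x : R) (st : state) : state :=
  State (reg st) (mem st) (rcons (out st) x) (steps st).

Definition tick (n : nat) (st : state) : state :=
  State (reg st) (mem st) (out st) (steps st + n).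

Definition eval_un (op : unop) (x : R) : R :=
  match op with
  | Floor => (Num.floor x)%:~R
  | Sqrt => Num.sqrt x
  | Log => ln x
  end.

Definition eval_bin (op : binop) (x y : R) : R :=
  match op with
  | Add => x + y
  | Sub => x - y
  | Mul => x * y
  | Div => x / y
  end.

Definition eval_cmp (op : cmpop) (x y : R) : bool :=
  match op with
  | Le => x <= y
  | Lt => x < y
  | Eq => x == y
  end.

Fixpoint eval (st : state) (e : expr) : R :=
  match e with
  | Lit n => n%:R
  | Var v => reg st v
  | Arr a i => mem st a (Num.truncn (eval st i))
  | Un op e1 => eval_un op (eval st e1)
  | Bin op e1 e2 => eval_bin op (eval st e1) (eval st e2)
  end.

Definition eval_test (st : state) (t : test) : bool :=
  let: Test op e1 e2 := t in eval_cmp op (eval st e1) (eval st e2).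

(* One step for each constant, each access to a variable or an array cell and
   each operation. *)
Fixpoint ecost (e : expr) : nat :=
  match e with
  | Lit _ | Var _ => 1
  | Arr _ i => (ecost i).+1
  | Un _ e1 => (ecost e1).+1
  | Bin _ e1 e2 => (ecost e1 + ecost e2).+1
  end.

Definition tcost (t : test) : nat :=
  let: Test _ e1 e2 := t in (ecost e1 + ecost e2).+1.

Definition argsort (f : nat -> R) (n : nat) : seq nat :=
  sort (fun p q => f p <= f q) (iota 1 n).

(* [sc n] is the number of steps charged for sorting n numbers.  A loop is
   charged three steps (increment, comparison, write) for each iteration and
   two (first write, last comparison) in addition. *)
Fixpoint exec (sc : nat -> nat) (c : cmd) (st : state) : state :=
  match c with
  | Skip => st
  | Assign v e => tick (ecost e + 1) (set_reg v (eval st e) st)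
  | Store a i e =>
      let p := Num.truncn (eval st i) in
      let x := eval st e in
      tick (ecost i + ecost e + 1)
        (set_arr a (fun q => if q == p then x else mem st a q) st)
  | Seq c1 c2 => exec sc c2 (exec sc c1 st)
  | If t c1 c2 =>
      let st' := tick (tcost t) st in
      if eval_test st t then exec sc c1 st' else exec sc c2 st'
  | For v e1 e2 c1 =>
      let lo := eval st e1 in
      let hi := eval st e2 in
      iteri (Num.truncn (hi - lo + 1))
        (fun r st' => exec sc c1 (tick 3 (set_reg v (lo + r%:R) st')))
        (tick (ecost e1 + ecost e2 + 2) st)
  | ArgSort d a e =>
      let n := Num.truncn (eval st e) in
      let perm := argsort (mem st a) n in
      tick (ecost e + sc n + 1)
        (set_arr d (fun q => if (0 < q <= n)%N then (nth 0%N perm q.-1)%:R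
                             else mem st d q) st)
  | Output e => tick (ecost e + 1) (emit (eval st e) st)
  end.

End Semantics.

Local Open Scope prog_scope.

(* v := 2^e, by repeated multiplication *)
Definition pow2 (v : var) (e : expr) : cmd :=
  v ::= 1 ;; For vt 1 e (v ::= 2 * v).

(* v := round(r) /\ M, the index denoted by a real number r when M numbers are
   sorted; ties are rounded up. *)
Definition set_index (v : var) (r : expr) (M : var) : cmd :=
  v ::= Un Floor (r + 1 / 2) ;; If (M < v) (v ::= M) Skip.

(* v := x log(x / y), with 0 log 0 = 0 *)
Definition xlog (v : var) (x y : expr) : cmd :=
  If (x == 0) (v ::= 0) (v ::= x * Un Log (x / y)).

(* vnR = number of locations in the rectangle, vkR = number of those with
   label 1, vK = total number of labels 1 *)
Definition compute_T : cmd :=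
  vT ::= 0 ;;
  If (vnR == 0) Skip (If (vnR == vN) Skip (
  If (vK == 0) Skip (If (vK == vN) Skip (
    vpbar ::= vK / vN ;;
    vphat ::= vkR / vnR ;;
    vqhat ::= (vK - vkR) / (vN - vnR) ;;
    If (vqhat <= vphat)
      (xlog vx1 vphat vpbar ;;
       xlog vx2 (1 - vphat) (1 - vpbar) ;;
       xlog vx3 vqhat vpbar ;;
       xlog vx4 (1 - vqhat) (1 - vpbar) ;;
       vT ::= vnR * (vx1 + vx2) + (vN - vnR) * (vx3 + vx4))
      Skip)))).

(* The locations with X-coordinate in the current X-interval are those with
   X-rank vla, ..., vra; they are extracted into aE (Y-coordinates) and aF
   (labels). *)
Definition extract : cmd :=
  If (vla <= vra) (vM ::= vra - vla + 1) (vM ::= 0) ;;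
  For vp 1 vM
    (vq ::= aP.[vla + vp - 1] ;;
     Store aE vp aY.[vq] ;;
     Store aF vp aB.[vq]).

(* aS[p] := number of labels 1 among the p extracted locations with the
   smallest Y-coordinates *)
Definition cumulate : cmd :=
  ArgSort aQ aE vM ;;
  Store aS 0 0 ;;
  For vp 1 vM (Store aS vp (aS.[vp - 1] + aF.[aQ.[vp]])).

(* The counts are obtained from the indices vlb and vrb, both already truncated
   at vM; the label count starts from the index just below the truncated vlb,
   so that the two counts agree when round(a) = vM + 1. *)
Definition count_rectangle : cmd :=
  vnR ::= 0 ;;
  vkR ::= 0 ;;
  If (1 <= vM)
    (If (vlb <= vrb)
      (vnR ::= vrb - vlb + 1 ;;
       vkR ::= aS.[vrb] - aS.[vlb - 1])
      Skip)
    Skip.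

Definition scan_rectangles : cmd :=
  For vm 0 (Un Floor (vw / veps))
    (For vn (vm + 1) (vm + Un Floor (2 / veps))
      (set_index vlb (vm * veps / vw * vM + 1) vM ;;
       set_index vrb (vn * veps / vw * vM) vM ;;
       count_rectangle ;;
       compute_T ;;
       Output vT)).

Definition algorithm : cmd :=
  vK ::= 0 ;;
  For vp 1 vN (vK ::= vK + aB.[vp]) ;;
  ArgSort aP aX vN ;;
  For vell 3 (Un Floor (Un Log (vN / (2 * Un Log vN)) / Un Log 2))
    (pow2 vs vell ;;
     vs ::= 1 / vs ;;
     veps ::= 1 / Un Sqrt vell / 6 ;;
     For vi 0 vell
       (pow2 vw vi ;;
        For vj 0 (Un Floor (1 / (veps * vs * vw)))
          (For vk (vj + 1) (vj + Un Floor (1 / veps))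
            (set_index vla (vj * veps * vs * vw * vN + 1) vN ;;
             set_index vra (vk * veps * vs * vw * vN) vN ;;
             extract ;;
             cumulate ;;
             scan_rectangles)))).

Local Close Scope prog_scope.

Local Open Scope ring_scope.

(* Input: N in the register vN and, for p = 1, ..., N, the location
   (aX[p], aY[p]) and its label aB[p]. *)
Definition init (R : realType) (N : nat) (X Y : N.-tuple R)
    (B : N.-tuple bool) : state R :=
  State (fun v => if v is vN then N%:R else 0)
        (fun a p => if (0 < p <= N)%N then
                      match a with
                      | aX => nth 0 X p.-1
                      | aY => nth 0 Y p.-1
                      | aB => (nth false B p.-1)%:R
                      | _ => 0
                      end
                    else 0)
        [::] 0%N.

Section Spec.
Variable R : realType.

(* round(r) /\ M, for r >= 0 *)
Definition index_of (M : nat) (r : R) : nat :=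
  minn (Num.truncn (r + 2^-1)) M.

(* s_(r); for the index 0 the value is irrelevant: a left
   index is 0 only if s is empty, and an interval of right index 0 is empty. *)
Definition order_stat (s : seq R) (r : R) : R :=
  nth 0 (sort <=%R s) (index_of (size s) r).-1.

(* membership in the interval [s_(a), s_(b)], empty if its right index is
   smaller than its left index *)
Definition in_interval (s : seq R) (a b x : R) : bool :=
  [&& (index_of (size s) a <= index_of (size s) b)%N,
      order_stat s a <= x & x <= order_stat s b].

Definition xlogq (x y : R) : R := if x == 0 then 0 else x * ln (x / y).

Definition eps (l : nat) : R := (Num.sqrt l%:R)^-1 / 6.

Definition scale (l : nat) : R := 2 ^- l.

Definition lmax (N : nat) : nat :=
  Num.truncn (ln (N%:R / (2 * ln N%:R)) / ln 2 : R).

Section Locations.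
Variables (N : nat) (X Y : N.-tuple R) (B : N.-tuple bool).

(* The statistic on the rectangle with membership test [rect]. *)
Definition T_stat (rect : R -> R -> bool) : R :=
  let inside := [set p : 'I_N | rect (tnth X p) (tnth Y p)] in
  let ones := [set p : 'I_N | tnth B p] in
  let nR := #|inside| in
  let pbar : R := #|ones|%:R / N%:R in
  let phat : R := #|inside :&: ones|%:R / nR%:R in
  let qhat : R := #|~: inside :&: ones|%:R / #|~: inside|%:R in
  if [|| nR == 0%N, nR == N, pbar == 0 | pbar == 1] then 0
  else if qhat <= phat then
    nR%:R * (xlogq phat pbar + xlogq (1 - phat) (1 - pbar))
    + (N%:R - nR%:R) * (xlogq qhat pbar + xlogq (1 - qhat) (1 - pbar))
  else 0.

Definition in_strip (l i j k : nat) (x : R) : bool :=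
  in_interval X (j%:R * eps l * scale l * 2 ^+ i * N%:R + 1)
                (k%:R * eps l * scale l * 2 ^+ i * N%:R) x.

Definition extracted (l i j k : nat) : seq R :=
  [seq tnth Y p | p <- enum 'I_N & in_strip l i j k (tnth X p)].

Definition in_rect (l i j k m n : nat) (x y : R) : bool :=
  let s := extracted l i j k in
  in_strip l i j k x &&
  in_interval s (m%:R * eps l * 2 ^- i * (size s)%:R + 1)
                (n%:R * eps l * 2 ^- i * (size s)%:R) y.

Definition all_T : seq R :=
  \big[cat/[::]]_(3 <= l < (lmax N).+1)
  \big[cat/[::]]_(0 <= i < l.+1)
  \big[cat/[::]]_(0 <= j < (Num.truncn ((eps l * scale l * 2 ^+ i)^-1)).+1)
  \big[cat/[::]]_(j.+1 <= k < (j + Num.truncn (eps l)^-1).+1)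
  \big[cat/[::]]_(0 <= m < (Num.truncn (2 ^+ i / eps l)).+1)
  \big[cat/[::]]_(m.+1 <= n < (m + Num.truncn (2 / eps l)).+1)
    [:: T_stat (in_rect l i j k m n)].

End Locations.
End Spec.

(* Main.v *)
Require Import Defs.
From HB Require Import structures.
From mathcomp Require Import all_boot all_order all_algebra.
From mathcomp Require Import reals exp.
From mathcomp Require Import zify ring lra.

Set Implicit Arguments.
Unset Strict Implicit.
Unset Printing Implicit Defensive.

Import Order.TTheory GRing.Theory Num.Theory.
Local Open Scope ring_scope.

(** Correctness and running time are proved together: for each part of the
    program, one statement says which property of the registers and arrays it
    establishes, which list it appends to the output, and how many steps it
    takes at most ([triple]).

    What the program computes.  Sorting by X numbers the locations by X-rank,
    and as the X-coordinates are distinct, the locations of a strip are those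
    of a run of consecutive ranks.  Inside a strip the same holds for the
    Y-ranks, so that a rectangle is a run of consecutive entries of the strip
    listed by increasing Y (in_interval_slice, in_strip_mem, in_rect_mem).  The
    number of locations of a rectangle is the length of its run, its number of
    labels 1 is a difference of two prefix sums, and the statistic is a
    function of these two numbers (T_stat_rect, reg_count_rectangle).

    Why it is fast.  Fix a level l, put s = 2^-l and e = 1 / epsilon, so that
    e^2 = 36 l, and fix i <= l.  As k - j <= e, a strip has at most
    s 2^i N + 1 locations (size_strip_le); extracting and sorting them takes
    O(s 2^i N log N) steps and the O(2^i e^2) rectangles in it take O(1) steps
    each.  There are O(e^2 / (s 2^i)) strips, so the factor 2^i cancels and
    the pair (l, i) takes O(2^l e^4 + e^2 N log N) steps (triple_scale).  The
    last level is chosen such that 2^l <= N / (2 log N) and l <= 2 log N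
    (level_bounds); therefore 2^l l^2 = O(N log N), and the bound becomes
    O(N log^2 N) for each pair (scale_time_le).  Summing over the O(log N)
    values of i and of l gives the two remaining logarithms. *)

(** * Reasoning about programs *)

(** Upper bounds for the registers and arrays that a command can change.  They
    are computed from the syntax, so that the frame conditions of a concrete
    program part hold by evaluation. *)
Fixpoint assigns (c : cmd) (u : var) : bool :=
  match c with
  | Assign v _ => var_beq u v
  | Seq c1 c2 => assigns c1 u || assigns c2 u
  | If _ c1 c2 => assigns c1 u || assigns c2 u
  | For v _ _ c1 => var_beq u v || assigns c1 u
  | _ => false
  end.

Fixpoint stores (c : cmd) (b : arr) : bool :=
  match c with
  | Store a _ _ => arr_beq b a
  | ArgSort d _ _ => arr_beq b d
  | Seq c1 c2 => stores c1 b || stores c2 b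
  | If _ c1 c2 => stores c1 b || stores c2 b
  | For _ _ _ c1 => stores c1 b
  | _ => false
  end.

(** Commands without loops, sorting and output have a running time bounded by a
    number that can be read off the syntax, [maxcost]. *)
Fixpoint straight (c : cmd) : bool :=
  match c with
  | Skip | Assign _ _ | Store _ _ _ => true
  | Seq c1 c2 => straight c1 && straight c2
  | If _ c1 c2 => straight c1 && straight c2
  | _ => false
  end.

Fixpoint maxcost (c : cmd) : nat :=
  match c with
  | Assign _ e => ecost e + 1
  | Store _ i e => ecost i + ecost e + 1
  | Seq c1 c2 => maxcost c1 + maxcost c2
  | If t c1 c2 => tcost t + maxn (maxcost c1) (maxcost c2)
  | _ => 0
  end.

Lemma var_beq_refl v : var_beq v v.
Proof. by case: v. Qed.

Section Execution.
Variables (R : realType) (sc : nat -> nat).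
Implicit Types (st : state R) (c : cmd).

Definition unchanged c st st' : Prop :=
  (forall u, assigns c u = false -> reg st' u = reg st u) /\
  (forall b, stores c b = false -> Defs.mem st' b = Defs.mem st b).

Lemma unchanged_trans c st1 st2 st3 :
  unchanged c st1 st2 -> unchanged c st2 st3 -> unchanged c st1 st3.
Proof.
move=> [r12 m12] [r23 m23]; split=> [u|b] h.
  by rewrite r23 ?r12.
by rewrite m23 ?m12.
Qed.

Lemma unchanged_sub c c' st st' :
  (forall u, assigns c u -> assigns c' u) ->
  (forall b, stores c b -> stores c' b) ->
  unchanged c st st' -> unchanged c' st st'.
Proof.
move=> sa ss [r m]; split=> [u|b] h.
  by apply: r; apply/negP => /sa; rewrite h.
by apply: m; apply/negP => /ss; rewrite h.
Qed.

Lemma iteri_ind T (P : nat -> T -> Prop) (f : nat -> T -> T) n x :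
  P 0 x -> (forall r y, (r < n)%N -> P r y -> P r.+1 (f r y)) ->
  P n (iteri n f x).
Proof.
move=> P0 PS; elim: n PS => [//|n IH] PS /=.
by apply: (PS) => //; apply: IH => r y rn; apply: PS; apply: ltnW.
Qed.

Lemma exec_unchanged c st : unchanged c st (exec sc c st).
Proof.
elim: c st => [|v e|a i e|c1 IH1 c2 IH2|t c1 IH1 c2 IH2|v e1 e2 c IH|d a e|e]
  st //=.
- by split=> //= u ->.
- by split=> //= u ->.
- apply: (@unchanged_trans _ _ (exec sc c1 st)).
    by apply: unchanged_sub (IH1 st) => //= ? ->.
  by apply: unchanged_sub (IH2 _) => //= ? ->; rewrite orbT.
- case: (eval_test st t).
    by apply: unchanged_sub (IH1 (tick (tcost t) st)) => //= ? ->.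
  by apply: unchanged_sub (IH2 (tick (tcost t) st)) => //= ? ->; rewrite orbT.
- set n := Num.truncn _; set f := fun (r : nat) st' => _.
  apply: (iteri_ind (P := fun _ => unchanged (For v e1 e2 c) st)) => // r st' _ h.
  apply: unchanged_trans h _.
  apply: (@unchanged_trans _ _ (tick 3 (set_reg v (eval st e1 + r%:R) st'))).
    by split=> //= u /norP[/negbTE ->].
  by apply: unchanged_sub (IH _) => //= ? ->; rewrite orbT.
- by split=> //= u ->.
Qed.

Lemma exec_straight c st : straight c ->
  out (exec sc c st) = out st /\
  (steps (exec sc c st) <= steps st + maxcost c)%N.
Proof.
elim: c st => [|v e|a i e|c1 IH1 c2 IH2|t c1 IH1 c2 IH2|v e1 e2 c IH|d a e|e]
  st //=.
- by rewrite addn0.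
- case/andP=> s1 s2; have [o1 t1] := IH1 st s1.
  have [-> t2] := IH2 (exec sc c1 st) s2; split=> //; lia.
- case/andP=> s1 s2.
  case: (eval_test st t).
    by have [-> /= h] := IH1 (tick (tcost t) st) s1; split=> //; lia.
  by have [-> /= h] := IH2 (tick (tcost t) st) s2; split=> //; lia.
Qed.

(** The steps are compared in R, where the bounds involve logarithms.  The
    state st is a parameter, and not only a precondition, because bounds and
    outputs depend on the values of its registers. *)
Definition triple c st (Q : state R -> Prop) (o : seq R) (w : R) : Prop :=
  [/\ Q (exec sc c st), out (exec sc c st) = out st ++ o
    & (steps (exec sc c st))%:R <= (steps st)%:R + w].

Lemma triple_weaken c st (Q Q' : state R -> Prop) o w w' :
  triple c st Q o w -> (forall st', unchanged c st st' -> Q st' -> Q' st') ->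
  w <= w' -> triple c st Q' o w'.
Proof.
case=> q e t QQ ww; split=> //; first exact: QQ (exec_unchanged c st) q.
by apply: le_trans t _; rewrite lerD2l.
Qed.

Lemma triple_straight c st (Q : state R -> Prop) w :
  straight c -> Q (exec sc c st) -> (maxcost c)%:R <= w ->
  triple c st Q [::] w.
Proof.
move=> /(exec_straight st)[o t] q h; split; rewrite ?cats0 //.
apply: (@le_trans _ _ (steps st + maxcost c)%:R); first by rewrite ler_nat.
by rewrite natrD lerD2l.
Qed.

(** In the program only the last part of a sequence produces output. *)
Lemma triple_seq c1 c2 st (Q1 Q : state R -> Prop) o w1 w2 :
  triple c1 st Q1 [::] w1 ->
  (forall st', unchanged c1 st st' -> Q1 st' -> triple c2 st' Q o w2) ->
  triple (Seq c1 c2) st Q o (w1 + w2).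
Proof.
case=> q1 e1 t1 /(_ _ (exec_unchanged c1 st) q1)[q2 e2 t2]; split=> //=.
  by rewrite e2 e1 cats0.
by apply: le_trans t2 _; lra.
Qed.

(** Between two iterations the loop itself advances the clock and overwrites
    its counter, hence the third premise; what the body does not change need
    not be part of the invariant. *)
Lemma triple_for (I : nat -> state R -> Prop) v e1 e2 c st lo n o w :
  eval st e1 = lo%:R -> Num.truncn (eval st e2 - lo%:R + 1) = n ->
  (forall r k x st', I r st' -> I r (tick k (set_reg v x st'))) ->
  I 0 (tick (ecost e1 + ecost e2 + 2) st) ->
  (forall r st', (r < n)%N -> unchanged (For v e1 e2 c) st st' ->
     reg st' v = (lo + r)%:R -> I r st' -> triple c st' (I r.+1) (o (lo + r)%N) w) ->
  triple (For v e1 e2 c) st (I n) (\big[cat/[::]]_(lo <= x < lo + n) o x)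
    ((ecost e1 + ecost e2 + 2)%:R + n%:R * (w + 3)).
Proof.
move=> elo en Istab I0 body; rewrite /triple /= elo en.
set f := fun (r : nat) st' => _; set st0 := tick _ _.
pose P r st' := [/\ unchanged (For v e1 e2 c) st st', I r st',
  out st' = out st ++ \big[cat/[::]]_(lo <= x < lo + r) o x &
  (steps st')%:R <= (steps st0)%:R + r%:R * (w + 3)].
have : P n (iteri n f st0).
  apply: iteri_ind => [|r st' rn [us Is os ts]].
    by split=> //; [rewrite addn0 big_geq // cats0 | rewrite mul0r addr0].
  set st1 := tick 3 (set_reg v (lo%:R + r%:R) st').
  have u1 : unchanged (For v e1 e2 c) st st1.
    by apply: unchanged_trans us _; split=> //= u /norP[/negbTE ->].
  have rv : reg st1 v = (lo + r)%:R.
    by rewrite /= var_beq_refl natrD.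
  have [q oq tq] := body r st1 rn u1 rv (Istab _ _ _ _ Is).
  split=> //.
  - apply: unchanged_trans u1 _.
    by apply: unchanged_sub (exec_unchanged c st1) => //= ? ->; rewrite orbT.
  - by rewrite oq /= os addnS big_nat_recr ?leq_addr //= catA.
  - apply: le_trans tq _; move: ts; rewrite /= -[r.+1%:R]natr1 natrD mulrDl; lra.
case=> _ In on tn; split=> //.
by apply: le_trans tn _; rewrite /= !natrD; lra.
Qed.

End Execution.

(** * Runs of consecutive ranks *)

(** The entries of t of ranks a, ..., b, where ranks start at 1; this is empty
    if b < a, as long as 0 < a. *)
Definition slice (T : Type) (a b : nat) (t : seq T) : seq T :=
  take (b - a.-1) (drop a.-1 t).

Section Slices.
Variables (T : Type) (x0 : T).
Implicit Types t : seq T.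

Lemma size_slice a b t : (b <= size t)%N -> size (slice a b t) = (b - a.-1)%N.
Proof. by move=> bt; rewrite size_takel ?size_drop //; lia. Qed.

Lemma nth_slice a b t r : (r < b - a.-1)%N ->
  nth x0 (slice a b t) r = nth x0 t (a.-1 + r).
Proof. by move=> rb; rewrite nth_take // nth_drop. Qed.

Lemma slice_empty a b t : (0 < a)%N -> (b < a)%N -> slice a b t = [::].
Proof. by move=> a0 ba; rewrite /slice (_ : (b - a.-1)%N = 0%N) ?take0 //; lia. Qed.

Lemma count_slice (h : pred T) a b t : (0 < a <= b)%N ->
  count h (take b t) = (count h (take a.-1 t) + count h (slice a b t))%N.
Proof.
move=> ab; rewrite -count_cat -takeD; congr (count _ (take _ _)); lia.
Qed.
End Slices.

Lemma mem_slice (T : eqType) a b (t : seq T) x : x \in slice a b t -> x \in t.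
Proof. by move/mem_take/mem_drop. Qed.

Lemma uniq_slice (T : eqType) a b (t : seq T) : uniq t -> uniq (slice a b t).
Proof. by move=> ut; rewrite take_uniq ?drop_uniq. Qed.

Section Ranks.
Variables (R : realType) (f : nat -> R) (t : seq nat).
Hypothesis f_sorted : sorted <%R (map f t).

Lemma le_nth_sorted i j : (i < size t)%N -> (j < size t)%N ->
  (f (nth 0%N t i) <= f (nth 0%N t j)) = (i <= j)%N.
Proof.
move=> it jt; rewrite -!(nth_map 0%N 0) //.
by apply: (lt_sorted_leq_nth 0 f_sorted); rewrite inE size_map.
Qed.

(** A list that f sorts strictly is also sorted by rank, so an interval with
    endpoints in the list contains a run of it. *)
Lemma mem_slice_sorted (a b x : nat) :
  x \in t -> (0 < a <= size t)%N -> (b <= size t)%N ->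
  (x \in slice a b t) =
  [&& (a <= b)%N, f (nth 0%N t a.-1) <= f x & f x <= f (nth 0%N t b.-1)].
Proof.
move=> xt /andP[a0 at_] bt.
have ut : uniq t.
  by apply: (@map_uniq _ _ f); exact: lt_sorted_uniq f_sorted.
case: (leqP a b) => [ab|ba] /=; last by rewrite slice_empty.
have rt : (index x t < size t)%N by rewrite index_mem.
rewrite -{2 3}(nth_index 0%N xt) !le_nth_sorted //; [|lia|lia].
apply/idP/idP => [h|/andP[h1 h2]].
  have := h; rewrite -index_mem size_slice // => hr.
  have e : nth 0%N t (a.-1 + index x (slice a b t)) = x.
    by rewrite -(@nth_slice _ 0%N a b) ?nth_index.
  have -> : index x t = (a.-1 + index x (slice a b t))%N.
    rewrite -{1}e index_uniq //; apply: leq_trans bt.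
    by rewrite -ltn_subRL.
  by rewrite leq_addr -ltnS prednK ?(leq_trans a0) // -ltn_subRL.
have -> : x = nth 0%N (slice a b t) (index x t - a.-1).
  by rewrite nth_slice; [rewrite subnKC // nth_index | lia].
by apply: mem_nth; rewrite size_slice //; lia.
Qed.

Lemma index_of_le M (r : R) : (index_of M r <= M)%N.
Proof. exact: geq_minr. Qed.

Lemma index_of_gt0 M (r : R) : (0 < M)%N -> 1 <= r -> (0 < index_of M r)%N.
Proof. by move=> M0 r1; rewrite leq_min M0 andbT truncn_gt0; lra. Qed.

(** The order statistics of s do not depend on the order in which s lists its
    members, so s can be any rearrangement of the values of f on t. *)
Lemma in_interval_slice (s : seq R) (r1 r2 : R) (x : nat) :
  perm_eq s (map f t) -> 1 <= r1 -> x \in t ->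
  in_interval s r1 r2 (f x) =
  (x \in slice (index_of (size t) r1) (index_of (size t) r2) t).
Proof.
move=> st h1 xt.
have t0 : (0 < size t)%N by case: (t) xt.
have es : sort <=%R s = map f t.
  rewrite (perm_sortP le_total le_trans le_anti _ _ st).
  move: f_sorted; rewrite lt_sorted_uniq_le => /andP[_] /sorted_sort -> //.
  exact: le_trans.
have sz : size s = size t by rewrite (perm_size st) size_map.
rewrite /in_interval /order_stat es sz mem_slice_sorted ?index_of_le ?index_of_gt0 //.
have le1 := index_of_le (size t) r1; have le2 := index_of_le (size t) r2.
by rewrite !(nth_map 0%N) //; lia.
Qed.

End Ranks.

Section ArgSort.
Variable R : realType.
Implicit Types f g : nat -> R.

Lemma argsort_perm f n : perm_eq (argsort f n) (iota 1 n).
Proof. by rewrite /argsort perm_sort. Qed.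

Lemma size_argsort f n : size (argsort f n) = n.
Proof. by rewrite (perm_size (argsort_perm f n)) size_iota. Qed.

Lemma mem_argsort f n p : (p \in argsort f n) = (0 < p <= n)%N.
Proof. by rewrite (perm_mem (argsort_perm f n)) mem_iota add1n ltnS. Qed.

Lemma nth_argsort f n p :
  (0 < p <= n)%N -> (0 < nth 0%N (argsort f n) p.-1 <= n)%N.
Proof. by move=> h; rewrite -(mem_argsort f) mem_nth // size_argsort; lia. Qed.

Lemma argsort_sorted f n :
  uniq (map f (iota 1 n)) -> sorted <%R (map f (argsort f n)).
Proof.
by move=> u; rewrite /argsort -sort_map sort_lt_sorted.
Qed.
End ArgSort.

(** * Strips and rectangles as runs of ranks *)

Section Locations.
Variables (R : realType) (N : nat) (X Y : N.-tuple R) (B : N.-tuple bool).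
Hypothesis N_gt0 : (0 < N)%N.

Definition label (p : nat) : bool := nth false B p.-1.
Definition locX : nat -> R := Defs.mem (init X Y B) aX.
Definition locY : nat -> R := Defs.mem (init X Y B) aY.

Lemma locX_tnth (p : 'I_N) : locX p.+1 = tnth X p.
Proof. by rewrite /locX /= ltn_ord -tnth_nth. Qed.

Lemma locY_tnth (p : 'I_N) : locY p.+1 = tnth Y p.
Proof. by rewrite /locY /= ltn_ord -tnth_nth. Qed.

Lemma map_locX : map locX (iota 1 N) = X.
Proof.
apply: (@eq_from_nth _ 0) => [|r]; rewrite size_map size_iota ?size_tuple // => rN.
by rewrite (nth_map 0%N) ?size_iota // nth_iota // /locX /= rN.
Qed.

Lemma map_locY : map locY (iota 1 N) = Y.
Proof.
apply: (@eq_from_nth _ 0) => [|r]; rewrite size_map size_iota ?size_tuple // => rN.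
by rewrite (nth_map 0%N) ?size_iota // nth_iota // /locY /= rN.
Qed.

(** Locations are numbered from 1 in the arrays and from 0 in the tuples. *)
Lemma card_count (L : seq nat) (h : pred nat) :
  uniq L -> {subset L <= iota 1 N} ->
  #|[set p : 'I_N | (p.+1 \in L) && h p.+1]| = count h L.
Proof.
move=> uL LN; rewrite cardE -size_filter.
set A := [set p : 'I_N | _].
rewrite -(size_map (fun p : 'I_N => p.+1)); apply: perm_size.
apply: uniq_perm; rewrite ?filter_uniq //.
  rewrite map_inj_uniq ?enum_uniq // => p q [] pq; exact: val_inj.
move=> x; rewrite mem_filter andbC; apply/mapP/andP => [[p]|[xL hx]].
  by rewrite mem_enum inE => /andP[pL hp] ->.
have := LN _ xL; rewrite mem_iota => /andP[x0 xN].
have xN' : (x.-1 < N)%N by lia.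
have ex : x = (Ordinal xN').+1 by rewrite /= prednK.
by exists (Ordinal xN'); rewrite // mem_enum inE -ex xL.
Qed.

Definition ones : nat := count label (iota 1 N).

Lemma ones_card : #|[set p : 'I_N | tnth B p]| = ones.
Proof.
rewrite /ones -card_count ?iota_uniq //; apply: eq_card => p.
by rewrite !inE mem_iota /= add1n ltnS ltn_ord /label -tnth_nth.
Qed.

(** The statistic of a rectangle with n locations, k of them with label 1. *)
Definition T_counts (n k : nat) : R :=
  let pbar : R := ones%:R / N%:R in
  let phat : R := k%:R / n%:R in
  let qhat : R := (ones%:R - k%:R) / (N%:R - n%:R) in
  if [|| n == 0%N, n == N, ones == 0%N | ones == N] then 0
  else if qhat <= phat then
    n%:R * (xlogq phat pbar + xlogq (1 - phat) (1 - pbar))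
    + (N%:R - n%:R) * (xlogq qhat pbar + xlogq (1 - qhat) (1 - pbar))
  else 0.

Lemma T_stat_counts (rect : R -> R -> bool) (L : seq nat) :
  uniq L -> {subset L <= iota 1 N} ->
  (forall p, rect (tnth X p) (tnth Y p) = (p.+1 \in L)) ->
  T_stat X Y B rect = T_counts (size L) (count label L).
Proof.
move=> uL LN rectL; rewrite /T_stat ones_card.
set inside := [set p | _]; set O := [set p | tnth B p].
have sizeE : #|inside| = size L.
  rewrite -count_predT -card_count //; apply: eq_card => p.
  by rewrite !inE rectL andbT.
have countE : #|inside :&: O| = count label L.
  rewrite -card_count //; apply: eq_card => p.
  by rewrite !inE rectL /label /= -tnth_nth.
have sizeC : #|~: inside|%:R = N%:R - (size L)%:R :> R.
  have := cardsC inside; rewrite card_ord sizeE.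
  by move/(congr1 (GRing.natmul (1 : R))) <-; rewrite natrD addrC addKr.
have countC : #|~: inside :&: O|%:R = ones%:R - (count label L)%:R :> R.
  have := cardsID inside O; rewrite ones_card setIC countE.
  move/(congr1 (GRing.natmul (1 : R))) <-.
  by rewrite natrD addrC addKr setDE setIC.
rewrite /T_counts sizeE countE sizeC countC.
have Nn0 : N%:R != 0 :> R by rewrite pnatr_eq0 -lt0n.
have -> : (ones%:R / N%:R == 0 :> R) = (ones == 0%N).
  by rewrite mulf_eq0 invr_eq0 (negbTE Nn0) orbF pnatr_eq0.
have -> // : (ones%:R / N%:R == 1 :> R) = (ones == N).
by rewrite -(inj_eq (mulIf Nn0)) divfK // mul1r eqr_nat.
Qed.

Section Strip.
Variables l i j k : nat.
Definition strip_left : nat :=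
  index_of N (j%:R * eps R l * scale R l * 2 ^+ i * N%:R + 1).
Definition strip_right : nat :=
  index_of N (k%:R * eps R l * scale R l * 2 ^+ i * N%:R).

(** The locations of a strip, by increasing X. *)
Definition strip : seq nat := slice strip_left strip_right (argsort locX N).

Lemma eps_ge0 : 0 <= eps R l.
Proof. by rewrite /eps divr_ge0 // invr_ge0 sqrtr_ge0. Qed.

Lemma scale_ge0 : 0 <= scale R l.
Proof. by rewrite /scale invr_ge0 exprn_ge0. Qed.

Lemma strip_coord_ge0 (q : nat) :
  0 <= q%:R * eps R l * scale R l * 2 ^+ i * N%:R.
Proof.
apply: mulr_ge0 => //; apply: mulr_ge0; last exact: exprn_ge0.
by apply: mulr_ge0 scale_ge0; apply: mulr_ge0 eps_ge0.
Qed.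

Lemma rect_coord_ge0 (q M : nat) : 0 <= q%:R * eps R l * 2 ^- i * M%:R.
Proof.
apply: mulr_ge0 => //; apply: mulr_ge0; last by rewrite invr_ge0 exprn_ge0.
by apply: mulr_ge0 eps_ge0.
Qed.

(** So the bounds on the numbers of iterations, which are multiples of this
    quantity, exceed 1, and rounding costs no more than constant factors. *)
Lemma inv_eps_ge6 : (0 < l)%N -> 6 <= (eps R l)^-1.
Proof.
move=> l_gt0; rewrite /eps invfM !invrK -[leLHS]mul1r ler_pM //.
by rewrite -[leLHS]sqrtr1 ler_sqrt ?ltr0n // ler1n.
Qed.

Lemma strip_uniq : uniq strip.
Proof. by rewrite uniq_slice // (perm_uniq (argsort_perm _ _)) iota_uniq. Qed.

Lemma strip_sub : {subset strip <= iota 1 N}.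
Proof. by move=> x /mem_slice; rewrite (perm_mem (argsort_perm _ _)). Qed.

Lemma strip_left_gt0 : (0 < strip_left)%N.
Proof.
apply: index_of_gt0 => //; rewrite lerDr.
exact: strip_coord_ge0.
Qed.

Lemma size_strip : size strip = (strip_right - strip_left.-1)%N.
Proof. by rewrite size_slice // size_argsort index_of_le. Qed.

(** The two ends of the strip are at most x - 1 apart before rounding, because
    (k - j) epsilon <= 1; rounding adds at most 1 to the difference, and a run
    with both ends included has one more element.  If the left end is truncated
    at N, the strip has at most one location. *)
Lemma size_strip_le (x : R) :
  (0 < l)%N -> x = scale R l * 2 ^+ i * N%:R ->
  (k <= j + Num.truncn (eps R l)^-1)%N -> (size strip)%:R <= x + 1.
Proof.
move=> l_gt0 xE kj; rewrite size_strip /strip_left /strip_right.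
have x0 : 0 <= x.
  by rewrite xE mulr_ge0 // mulr_ge0 ?exprn_ge0 // scale_ge0.
have e0 := eps_ge0.
have e6 := inv_eps_ge6 l_gt0.
have eps_gt0 : 0 < eps R l by rewrite -invr_gt0; lra.
set a := _ + 1; set b := k%:R * _ * _ * _ * _.
have ab : b <= a - 1 + x.
  have -> : a - 1 + x = (j%:R + (eps R l)^-1) * (eps R l * x).
    by rewrite /a xE; field; rewrite gt_eqF.
  have -> : b = k%:R * (eps R l * x) by rewrite /b xE; ring.
  apply: ler_wpM2r; first exact: mulr_ge0.
  apply: (@le_trans _ _ (j + Num.truncn (eps R l)^-1)%:R); first by rewrite ler_nat.
  by rewrite natrD lerD2l truncn_le; lra.
have b0 : 0 <= b := strip_coord_ge0 k.
have a0 : 0 <= a by rewrite addr_ge0 // strip_coord_ge0.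
clearbody a b; rewrite /index_of.
set p := Num.truncn (a + 2^-1); set q := Num.truncn (b + 2^-1).
have hp : a + 2^-1 < p%:R + 1 by rewrite natr1 truncnS_gt.
have hq : q%:R <= b + 2^-1 by rewrite truncn_le addr_ge0 // invr_ge0.
clearbody p q; clear b0 a0 e6 eps_gt0 e0.
case: (leqP N p) => [Np|pN].
  have : (minn q N - N.-1 <= 1)%N by lia.
  by rewrite -(ler_nat R); lra.
case: (leqP (minn q N) p.-1) => [h|h].
  by move: h; rewrite -subn_eq0 => /eqP ->; rewrite addr_ge0.
have : (minn q N - p.-1 + p <= q + 1)%N by lia.
by rewrite -(ler_nat R) !natrD; lra.
Qed.

Hypothesis uX : uniq X.

Lemma in_strip_mem (p : 'I_N) : in_strip X l i j k (tnth X p) = (p.+1 \in strip).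
Proof.
rewrite -locX_tnth /in_strip.
rewrite (@in_interval_slice _ locX (argsort locX N)) ?size_argsort //.
- by rewrite argsort_sorted // map_locX.
- by rewrite -{1}map_locX perm_sym; apply: perm_map; exact: argsort_perm.
- by rewrite lerDr strip_coord_ge0.
- by rewrite mem_argsort /=.
Qed.

Lemma extracted_perm : perm_eq (extracted X Y l i j k) (map locY strip).
Proof.
pose s := [seq p <- enum 'I_N | in_strip X l i j k (tnth X p)].
have -> : extracted X Y l i j k = map locY [seq (nat_of_ord p).+1 | p : 'I_N <- s].
  by rewrite -map_comp; apply: eq_map => p /=; rewrite locY_tnth.
apply/perm_map/uniq_perm; rewrite ?strip_uniq //.
  rewrite map_inj_uniq => [|p q [] pq]; last exact: val_inj.
  exact: filter_uniq (enum_uniq _).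
move=> x; apply/mapP/idP => [[p]|xs].
  by rewrite mem_filter in_strip_mem => /andP[ps _] ->.
have := strip_sub xs; rewrite mem_iota => /andP[x0 xN].
have xN' : (x.-1 < N)%N by lia.
have ex : x = (Ordinal xN').+1 by rewrite /= prednK.
by exists (Ordinal xN'); rewrite // mem_filter in_strip_mem -ex xs mem_enum.
Qed.

Section Rectangle.
Variables (m n : nat) (t : seq nat).
(* t lists the locations of the strip by increasing Y. *)
Hypotheses (t_strip : perm_eq t strip) (t_sorted : sorted <%R (map locY t)).

Definition rect_bottom : nat :=
  index_of (size t) (m%:R * eps R l * 2 ^- i * (size t)%:R + 1).
Definition rect_top : nat :=
  index_of (size t) (n%:R * eps R l * 2 ^- i * (size t)%:R).

Lemma in_rect_mem (p : 'I_N) :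
  in_rect X Y l i j k m n (tnth X p) (tnth Y p) =
  (p.+1 \in slice rect_bottom rect_top t).
Proof.
rewrite /in_rect in_strip_mem -(perm_mem t_strip).
case: (boolP (p.+1 \in t)) => [pt|/negP pt] /=; last first.
  by apply/esym/negP => /mem_slice.
have st : perm_eq (extracted X Y l i j k) (map locY t).
  by rewrite (perm_trans extracted_perm) // perm_map // perm_sym.
have sz : size (extracted X Y l i j k) = size t.
  by rewrite (perm_size st) size_map.
rewrite -locY_tnth (in_interval_slice t_sorted) //; first by rewrite sz.
by rewrite lerDr rect_coord_ge0.
Qed.

Lemma T_stat_rect :
  T_stat X Y B (in_rect X Y l i j k m n) =
  T_counts (size (slice rect_bottom rect_top t))
           (count label (slice rect_bottom rect_top t)).
Proof.
apply: T_stat_counts in_rect_mem.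
  by rewrite uniq_slice // (perm_uniq t_strip) strip_uniq.
by move=> x /mem_slice; rewrite (perm_mem t_strip) => /strip_sub.
Qed.

End Rectangle.
End Strip.
End Locations.

(** * Loops, indices and the statistic *)

Section Pieces.
Variables (R : realType) (sc : nat -> nat).
Implicit Types (st : state R) (c : cmd).

Lemma floor_truncn (x : R) : 0 <= x -> (Num.floor x)%:~R = (Num.truncn x)%:R :> R.
Proof.
move=> x0; rewrite truncn_floor x0 -[in LHS](@gez0_abs (Num.floor x)) //.
by rewrite floor_ge0.
Qed.

Lemma triple_silent_for (I : nat -> state R -> Prop) v e1 e2 c st lo n w :
  eval st e1 = lo%:R -> Num.truncn (eval st e2 - lo%:R + 1) = n ->
  (forall r k x st', I r st' -> I r (tick k (set_reg v x st'))) ->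
  I 0 (tick (ecost e1 + ecost e2 + 2) st) ->
  (forall r st', (r < n)%N -> unchanged (For v e1 e2 c) st st' ->
     reg st' v = (lo + r)%:R -> I r st' -> triple sc c st' (I r.+1) [::] w) ->
  triple sc (For v e1 e2 c) st (I n) [::]
    ((ecost e1 + ecost e2 + 2)%:R + n%:R * (w + 3)).
Proof.
move=> e1E nE Is I0 body.
have := triple_for (o := fun=> [::]) e1E nE Is I0 body.
by rewrite (big1_eq (op := cat)).
Qed.

(** The bound 2 b w leaves room for the cost of the loop control, so that the
    bounds of nested loops are plain products.  Such loops have no invariant:
    their bodies only use what the loop does not change. *)
Lemma triple_nested_for v e1 e2 c st lo n b o w :
  eval st e1 = lo%:R -> Num.truncn (eval st e2 - lo%:R + 1) = n ->
  n%:R <= b -> 1 <= b -> (ecost e1 + ecost e2 + 5)%:R <= w ->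
  (forall x st', (lo <= x < lo + n)%N -> unchanged (For v e1 e2 c) st st' ->
     reg st' v = x%:R -> triple sc c st' (fun=> True) (o x) w) ->
  triple sc (For v e1 e2 c) st (fun=> True)
    (\big[cat/[::]]_(lo <= x < lo + n) o x) (2 * b * w).
Proof.
move=> e1E nE nb b1 cw body.
have /(triple_weaken (Q' := fun=> True)) : triple sc (For v e1 e2 c) st (fun=> True)
    (\big[cat/[::]]_(lo <= x < lo + n) o x)
    ((ecost e1 + ecost e2 + 2)%:R + n%:R * (w + 3)).
  apply: (triple_for (I := fun _ _ => True)) => // r st' rn us rv _.
  by apply: body; rewrite // leq_addr ltn_add2l.
apply=> //; move: cw; move: (ecost e1 + ecost e2)%N => a; rewrite !natrD => cw.
have w0 : 0 <= w by apply: le_trans cw; rewrite addr_ge0.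
have : n%:R * (w + 3) <= b * (w + 3) by rewrite ler_wpM2r // addr_ge0.
have : a%:R <= b * a%:R by rewrite ler_peMl.
have : b * (a%:R + 5) <= b * w by rewrite ler_wpM2l //; lra.
lra.
Qed.

Lemma triple_pow2 v e st q :
  var_beq v vt = false ->
  eval (exec sc (Assign v 1%N) st) e = q%:R ->
  triple sc (pow2 v e) st (fun st' => reg st' v = 2 ^+ q) [::]
    ((ecost e + 5)%:R + 7 * q%:R).
Proof.
move=> vvt eE; pose I r (st' : state R) := reg st' v = 2 ^+ r :> R.
apply: (@triple_weaken _ _ _ _ (I q) _ _
  (2 + ((1 + ecost e + 2)%:R + q%:R * (4 + 3)))).
- apply: (triple_seq (Q1 := fun st' => st' = exec sc (Assign v 1%N) st)).
    by apply: triple_straight.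
  move=> _ _ ->; apply: (triple_silent_for (lo := 1) (n := q) (I := I)) => //.
  + by rewrite eE subrK natrK.
  + by move=> r k x st' h; rewrite /I /= vvt.
  + by rewrite /I /= var_beq_refl.
  + move=> r st' _ _ _ h; apply: triple_straight => //=.
    by rewrite /I /= var_beq_refl h exprS.
- by move=> st' _.
- by rewrite !natrD; lra.
Qed.

Lemma exec_set_index st v r M (x : R) (m : nat) :
  var_beq M v = false -> eval st r = x -> 0 <= x -> reg st M = m%:R ->
  reg (exec sc (set_index v r M) st) v = (index_of m x)%:R.
Proof.
move=> Mv rE x0 ME; rewrite /= Mv ME var_beq_refl rE div1r floor_truncn; last first.
  by rewrite addr_ge0 ?invr_ge0.
rewrite /index_of ltr_nat; by case: ltnP => _ /=; rewrite ?Mv var_beq_refl ?ME.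
Qed.

Lemma eval_tick k st e : eval (tick k st) e = eval st e.
Proof. by elim: e => //= [a e ->|op e ->|op e1 -> e2 ->]. Qed.

Lemma reg_xlog v x y st u :
  reg (exec sc (xlog v x y) st) u =
  if var_beq u v then xlogq (eval st x) (eval st y) else reg st u.
Proof. by rewrite /= /xlogq !eval_tick; case: (eval st x == 0). Qed.


Lemma exec_seq c1 c2 st : exec sc (Seq c1 c2) st = exec sc c2 (exec sc c1 st).
Proof. by []. Qed.

Lemma exec_assign v e st :
  exec sc (Assign v e) st = tick (ecost e + 1) (set_reg v (eval st e) st).
Proof. by []. Qed.

Lemma exec_if b e1 e2 c1 c2 st :
  exec sc (If (Test b e1 e2) c1 c2) st =
  exec sc (if eval_cmp b (eval st e1) (eval st e2) then c1 else c2)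
    (tick (ecost e1 + ecost e2).+1 st).
Proof. by rewrite /=; case: ifP. Qed.

End Pieces.

(* From here on exec is unfolded one command at a time: simplification would
   expand a whole nest of conditionals, with a copy of the state in each
   branch. *)
Local Arguments exec : simpl never.

Section Counting.
Variables (R : realType) (sc : nat -> nat).
Implicit Types st : state R.

Lemma reg_compute_T (N : nat) (B : N.-tuple bool) st (n k : nat) :
  reg st vN = N%:R -> reg st vK = (ones B)%:R ->
  reg st vnR = n%:R -> reg st vkR = k%:R ->
  reg (exec sc compute_T st) vT = T_counts R B n k.
Proof.
move=> NE KE nE kE; rewrite /T_counts.
rewrite /compute_T exec_seq exec_assign exec_if /= nE pnatr_eq0.
case: eqP => _ /=; first by [].
rewrite exec_if /= nE NE eqr_nat; case: eqP => _ /=; first by [].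
rewrite exec_if /= KE pnatr_eq0; case: eqP => _ /=; first by [].
rewrite exec_if /= KE NE eqr_nat; case: eqP => _ /=; first by [].
rewrite !exec_seq !exec_assign exec_if /= NE KE nE kE.
case: ifP => _ //=.
by do 4?rewrite ?reg_xlog /=; rewrite NE nE.
Qed.

(** The label count is the difference of two prefix sums.  When t is empty, the
    left index is 0 instead of 1; this is why 0 < a is only required for a
    nonempty t. *)
Lemma reg_count_rectangle st (lab : pred nat) (t : seq nat) a b :
  reg st vM = (size t)%:R -> reg st vlb = a%:R -> reg st vrb = b%:R ->
  (t != [::] -> 0 < a)%N -> (b <= size t)%N ->
  (forall p, (p <= size t)%N -> Defs.mem st aS p = (count lab (take p t))%:R) ->
  reg (exec sc count_rectangle st) vnR = (size (slice a b t))%:R /\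
  reg (exec sc count_rectangle st) vkR = (count lab (slice a b t))%:R.
Proof.
move=> ME aE bE a0 bt SE.
rewrite /count_rectangle !exec_seq !exec_assign exec_if /= ME ler1n.
case: t ME a0 bt SE => [|x t'] ME a0 bt SE.
  by rewrite /= /slice.
set t := x :: t' in ME a0 bt SE *.
rewrite /= exec_if /= aE bE ler_nat; case: leqP => [ab|ba] /=; last first.
  by rewrite slice_empty ?a0.
have a_gt0 : (0 < a)%N := a0 isT.
have aE1 : a%:R - 1 = a.-1%:R :> R by rewrite -subn1 natrB.
rewrite aE bE -natrB // aE1 !natrK !SE //; last by apply: leq_trans bt; lia.
rewrite size_slice //; split; first by rewrite natr1; congr _%:R; lia.
by rewrite (@count_slice _ lab a b) ?a_gt0 // natrD addrC addKr.
Qed.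

End Counting.

(** * Processing one strip *)

(* The bodies of the nested loops, from the innermost to the outermost one. *)
Definition process_rectangle : cmd :=
  (set_index vlb (vm * veps / vw * vM + 1%N) vM ;;
   set_index vrb (vn * veps / vw * vM) vM ;;
   count_rectangle ;;
   compute_T ;;
   Output vT)%prog.

Definition process_strip : cmd :=
  (set_index vla (vj * veps * vs * vw * vN + 1%N) vN ;;
   set_index vra (vk * veps * vs * vw * vN) vN ;;
   extract ;;
   cumulate ;;
   scan_rectangles)%prog.

Definition process_scale : cmd :=
  (pow2 vw vi ;;
   For vj 0%N (Un Floor (1%N / (veps * vs * vw)))
     (For vk (vj + 1%N) (vj + Un Floor (1%N / veps)) process_strip))%prog.

Definition process_level : cmd :=
  (pow2 vs vell ;;
   vs ::= 1%N / vs ;;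
   veps ::= 1%N / Un Sqrt vell / 6%N ;;
   For vi 0%N vell process_scale)%prog.

Lemma algorithmE : algorithm =
  (vK ::= 0%N ;;
   For vp 1%N vN (vK ::= vK + aB.[vp]) ;;
   ArgSort aP aX vN ;;
   For vell 3%N (Un Floor (Un Log (vN / (2%N * Un Log vN)) / Un Log 2%N))
     process_level)%prog.
Proof. by []. Qed.

Section Stages.
Variables (R : realType) (sc : nat -> nat).
Variables (N : nat) (X Y : N.-tuple R) (B : N.-tuple bool).
Hypotheses (N_gt0 : (0 < N)%N) (uX : uniq X) (uY : uniq Y).
Implicit Types (st : state R) (c : cmd).

Local Notation locX := (locX X Y B).
Local Notation locY := (locY X Y B).

(** What the preliminary sorting establishes and the main loop preserves. *)
Record ready st : Prop := Ready {
  ready_N : reg st vN = N%:R;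
  ready_K : reg st vK = (ones B)%:R;
  ready_Y : Defs.mem st aY = locY;
  ready_B : forall p, (0 < p <= N)%N -> Defs.mem st aB p = (label B p)%:R;
  ready_P : forall p, (0 < p <= N)%N ->
    Defs.mem st aP p = (nth 0%N (argsort locX N) p.-1)%:R
}.

Lemma ready_unchanged c st st' :
  ~~ [|| assigns c vN, assigns c vK, stores c aY, stores c aB | stores c aP] ->
  unchanged c st st' -> ready st -> ready st'.
Proof.
move=> /norP[/negbTE cN /norP[/negbTE cK /norP[/negbTE cY]]].
move=> /norP[/negbTE cB /negbTE cP] [r m] [hN hK hY hB hP].
by split; rewrite ?r ?m // => p hp; rewrite m // ?hB ?hP.
Qed.

Lemma triple_output e st :
  triple sc (Output e) st (fun=> True) [:: eval st e] (ecost e + 1)%:R.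
Proof. by split=> //=; rewrite ?cats1 // natrD. Qed.

Lemma loop_count_from0 (x : R) : 0 <= x ->
  Num.truncn ((Num.floor x)%:~R - 0%:R + 1 : R) = (Num.truncn x).+1.
Proof. by move=> x0; rewrite floor_truncn // subr0 natr1 natrK. Qed.

Lemma loop_count_after (m : nat) (x : R) : 0 <= x ->
  Num.truncn (m%:R + (Num.floor x)%:~R - m.+1%:R + 1 : R) = Num.truncn x.
Proof.
move=> x0; rewrite floor_truncn // -[m.+1%:R]natr1.
by rewrite (_ : _ + 1 = (Num.truncn x)%:R) ?natrK //; ring.
Qed.

Section Strip.
Variables l i j k : nat.
Hypothesis l_gt0 : (0 < l)%N.

Local Notation s := (strip X Y B l i j k).
Local Notation e := ((eps R l)^-1).

Section Scan.
Variable t : seq nat.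
Hypotheses (t_strip : perm_eq t s) (t_sorted : sorted <%R (map locY t)).

(** The situation in which the rectangles of a strip are enumerated: the array
    aS holds the prefix sums of the labels along t. *)
Record strip_sorted st : Prop := StripSorted {
  strip_ready : ready st;
  strip_eps : reg st veps = eps R l;
  strip_w : reg st vw = 2 ^+ i;
  strip_M : reg st vM = (size t)%:R;
  strip_S : forall p, (p <= size t)%N ->
    Defs.mem st aS p = (count (label B) (take p t))%:R
}.

Lemma strip_sorted_unchanged c st st' :
  ~~ [|| assigns c vN, assigns c vK, stores c aY, stores c aB | stores c aP] ->
  ~~ [|| assigns c veps, assigns c vw, assigns c vM | stores c aS] ->
  unchanged c st st' -> strip_sorted st -> strip_sorted st'.
Proof.
move=> c1 /norP[/negbTE ce /norP[/negbTE cw /norP[/negbTE cM /negbTE cS]]] u.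
move=> [h1 h2 h3 h4 h5]; have h1' := ready_unchanged c1 u h1.
by case: u => r m; split; rewrite ?r ?m.
Qed.

(** The number 167 is the maximal cost of the five instructions. *)
Lemma triple_rectangle st m n :
  strip_sorted st -> reg st vm = m%:R -> reg st vn = n%:R ->
  triple sc process_rectangle st (fun=> True)
    [:: T_stat X Y B (in_rect X Y l i j k m n)] 167.
Proof.
move=> h mE nE; apply: (@triple_weaken _ _ _ _ (fun=> True) _ _
  (20 + (18 + (24 + (103 + 2))))) => //; last by rewrite -!natrD.
apply: (triple_seq (Q1 := fun st' => reg st' vlb = (rect_bottom R l i m t)%:R)).
  apply: triple_straight => //; apply: exec_set_index => //.
  - by rewrite /= mE (strip_eps h) (strip_w h) (strip_M h).
  - by rewrite addr_ge0 // rect_coord_ge0.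
  - exact: strip_M h.
move=> st1 u1 aE.
have h1 : strip_sorted st1 by apply: strip_sorted_unchanged u1 h.
apply: (triple_seq (Q1 := fun st' => reg st' vrb = (rect_top R l i n t)%:R)).
  apply: triple_straight => //; apply: exec_set_index => //.
  - by rewrite /= u1.1 // nE (strip_eps h1) (strip_w h1) (strip_M h1).
  - by rewrite rect_coord_ge0.
  - exact: strip_M h1.
move=> st2 u2 bE; rewrite -(u2.1 vlb) // in aE.
have h2 : strip_sorted st2 by apply: strip_sorted_unchanged u2 h1.
pose L := slice (rect_bottom R l i m t) (rect_top R l i n t) t.
apply: (triple_seq (Q1 := fun st' =>
    reg st' vnR = (size L)%:R /\ reg st' vkR = (count (label B) L)%:R)).
  apply: triple_straight => //; apply: reg_count_rectangle => //.
  - exact: strip_M h2.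
  - move=> t0; apply: index_of_gt0; first by rewrite lt0n size_eq0.
    by rewrite lerDr rect_coord_ge0.
  - exact: index_of_le.
  - exact: strip_S h2.
move=> st3 u3 [nRE kRE].
have h3 : strip_sorted st3 by apply: strip_sorted_unchanged u3 h2.
apply: (triple_seq (Q1 := fun st' => reg st' vT =
    T_stat X Y B (in_rect X Y l i j k m n))).
  apply: triple_straight => //.
  rewrite (T_stat_rect N_gt0 uX m n t_strip t_sorted).
  apply: reg_compute_T => //; first exact: ready_N (strip_ready h3).
  exact: ready_K (strip_ready h3).
by move=> st4 u4 <-; apply: triple_output.
Qed.

(** The factors are, up to the rounding absorbed by the constants, the numbers
    of iterations of the two loops and the cost of one rectangle. *)
Lemma triple_scan st : strip_sorted st ->
  triple sc scan_rectangles st (fun=> True)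
    (\big[cat/[::]]_(0 <= m < (Num.truncn (2 ^+ i / eps R l)).+1)
     \big[cat/[::]]_(m.+1 <= n < (m + Num.truncn (2 / eps R l)).+1)
       [:: T_stat X Y B (in_rect X Y l i j k m n)])
    (2 * (2 * 2 ^+ i * e) * (2 * (2 * e) * 167)).
Proof.
move=> h; have e6 := inv_eps_ge6 R l_gt0.
have p1 : 1 <= 2 ^+ i :> R by rewrite exprn_ege1 // ler1n.
have pe : 2 ^+ i * e >= 6 by rewrite -[leLHS]mul1r ler_pM.
apply: (triple_nested_for (lo := 0%N) (n := (Num.truncn (2 ^+ i / eps R l)).+1)).
- by [].
- by rewrite /= (strip_w h) (strip_eps h) loop_count_from0 //; lra.
- rewrite -natr1; have : (Num.truncn (2 ^+ i / eps R l))%:R <= 2 ^+ i * e.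
    by rewrite truncn_le; lra.
  lra.
- lra.
- by rewrite /=; lra.
move=> m st1 _ u1 mE.
have h1 : strip_sorted st1 by apply: strip_sorted_unchanged u1 h.
apply: (triple_nested_for (lo := m.+1) (n := Num.truncn (2 / eps R l))).
- by rewrite /= mE natr1.
- by rewrite /= mE (strip_eps h1) loop_count_after //; lra.
- by rewrite truncn_le; lra.
- lra.
- by rewrite /=; lra.
move=> n st2 _ u2 nE.
have h2 : strip_sorted st2 by apply: strip_sorted_unchanged u2 h1.
by apply: triple_rectangle => //; rewrite u2.1.
Qed.

End Scan.


Definition extracted_locations st : Prop :=
  [/\ reg st vM = (size s)%:R,
     forall p, (p < size s)%N -> Defs.mem st aE p.+1 = locY (nth 0%N s p)
   & forall p, (p < size s)%N -> Defs.mem st aF p.+1 = (label B (nth 0%N s p))%:R].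

Lemma triple_extract st :
  ready st -> reg st vla = (strip_left R N l i j)%:R ->
  reg st vra = (strip_right R N l i k)%:R ->
  triple sc extract st extracted_locations [::] (13 + (size s)%:R * 18).
Proof.
move=> h laE raE.
have la0 := strip_left_gt0 R N_gt0 l i j.
have ra_le : (strip_right R N l i k <= N)%N := index_of_le _ _.
have sE := size_strip X Y B l i j k.
apply: (@triple_weaken _ _ _ _ extracted_locations _ _
  (9 + (4 + (size s)%:R * (15 + 3)))) => //; last by lra.
apply: (triple_seq (Q1 := fun st' => reg st' vM = (size s)%:R)).
  apply: triple_straight => //.
  rewrite exec_if /= laE raE ler_nat sE; case: leqP => ab; rewrite exec_assign /=.
    by rewrite laE raE -natrB // natr1; congr _%:R; lia.
  by rewrite (_ : (_ - _)%N = 0%N) //; lia.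
move=> st1 u1 ME.
pose I r (st' : state R) :=
  (forall p, (p < r)%N -> Defs.mem st' aE p.+1 = locY (nth 0%N s p)) /\
  (forall p, (p < r)%N -> Defs.mem st' aF p.+1 = (label B (nth 0%N s p))%:R).
set f := For _ _ _ _.
apply: (@triple_weaken _ _ _ _ (I (size s)) _ _
  ((1 + 1 + 2)%:R + (size s)%:R * (15 + 3))) => //.
  apply: triple_silent_for => //.
    by rewrite /= ME subrK natrK.
  move=> r st2 rs u2 rE [IE IF].
  have h2 : ready st2.
    by apply: ready_unchanged u2 _ => //; apply: ready_unchanged u1 h.
  have laE2 : reg st2 vla = (strip_left R N l i j)%:R by rewrite u2.1 // u1.1.
  have rs' : (r < strip_right R N l i k - (strip_left R N l i j).-1)%N.
    by rewrite -sE.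
  have pE : Num.truncn (reg st2 vla + reg st2 vp - 1%:R) = (strip_left R N l i j + r)%N.
    by rewrite laE2 rE -natrD -natrB ?natrK; [lia|lia].
  have qE : Defs.mem st2 aP (strip_left R N l i j + r) = (nth 0%N s r)%:R.
    rewrite (ready_P h2); last by lia.
    by rewrite /strip nth_slice //; congr (nth _ _ _)%:R; lia.
  apply: triple_straight => //; rewrite !exec_seq exec_assign /exec /= pE qE.
  rewrite rE !natrK.
  have sN : (0 < nth 0%N s r <= N)%N.
    have /strip_sub : nth 0%N s r \in s by rewrite mem_nth.
    by rewrite mem_iota add1n ltnS.
  split=> p; rewrite ltnS leq_eqVlt => /predU1P[->|pr].
  - by rewrite /= add1n eqxx (ready_Y h2).
  - by rewrite /= add1n eqSS ltn_eqF // IE.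
  - by rewrite /= add1n eqxx (ready_B h2).
  - by rewrite /= add1n eqSS ltn_eqF // IF.
move=> st2 u2 [IE IF]; split=> //.
by rewrite u2.1.
Qed.

Lemma map_locY_strip_uniq : uniq (map locY s).
Proof.
have ps : perm_eq s [seq p <- iota 1 N | p \in s].
  apply: uniq_perm; rewrite ?strip_uniq ?filter_uniq ?iota_uniq // => p.
  rewrite mem_filter; case: (boolP (p \in s)) => //= ps.
  by rewrite (strip_sub ps).
rewrite (perm_uniq (perm_map locY ps)).
apply: subseq_uniq (map_subseq _ (filter_subseq _ _)) _.
by rewrite map_locY.
Qed.

(** The order t in which the prefix sums are taken is only needed up to its
    characterization: it is the strip, sorted by Y. *)
Definition cumulated st : Prop :=
  exists t, [/\ perm_eq t s, sorted <%R (map locY t)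
    & forall p, (p <= size t)%N ->
        Defs.mem st aS p = (count (label B) (take p t))%:R].

(** Sorting yields a permutation of the positions 1, ..., M in the strip;
    replacing each position by the location there gives t. *)
Lemma triple_cumulate st : extracted_locations st ->
  triple sc cumulate st cumulated [::] ((sc (size s))%:R + 9 + (size s)%:R * 13).
Proof.
move=> [ME EE FE]; set M := size s in ME EE FE *.
pose g := Defs.mem st aE; pose tau := argsort g M.
pose t := [seq nth 0%N s q.-1 | q <- tau].
have s_nth : [seq nth 0%N s q.-1 | q <- iota 1 M] = s.
  by rewrite -[iota 1 M]/(iota (1 + 0) M) iotaDl -map_comp -/(mkseq _ _) mkseq_nth.
have t_s : perm_eq t s.
  by rewrite -[X in perm_eq _ X]s_nth; apply: perm_map; apply: argsort_perm.
have gE : map g tau = map locY t.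
  rewrite -map_comp; apply/eq_in_map => -[|q]; rewrite mem_argsort // => /andP[_ qM].
  by rewrite /g EE.
have t_sorted : sorted <%R (map locY t).
  rewrite -gE; apply: argsort_sorted.
  rewrite -(perm_uniq (perm_map g (argsort_perm g M))) gE.
  by rewrite (perm_uniq (perm_map locY t_s)) map_locY_strip_uniq.
have tM : size t = M by rewrite size_map size_argsort.
apply: (@triple_weaken _ _ _ _ cumulated _ _
  (((sc M)%:R + 2) + (3 + (4 + M%:R * (10 + 3))))) => //; last by lra.
apply: (triple_seq (Q1 := fun st' => forall q, (0 < q <= M)%N ->
    Defs.mem st' aQ q = (nth 0%N tau q.-1)%:R)).
  split; rewrite ?cats0 //.
    by move=> q hq; rewrite /exec /= ME natrK hq.
  by rewrite /exec /= ME natrK !natrD; lra.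
move=> st1 u1 QE.
apply: (triple_seq (Q1 := fun st' => Defs.mem st' aS 0%N = 0)).
  by apply: triple_straight => //; rewrite /exec /= truncn0.
move=> st2 u2 S0.
pose I r (st' : state R) := forall p, (p <= r)%N ->
  Defs.mem st' aS p = (count (label B) (take p t))%:R.
apply: (@triple_weaken _ _ _ _ (I M) _ _
  ((1 + 1 + 2)%:R + M%:R * (10 + 3))) => //; last first.
  by move=> st3 _ IM; exists t; rewrite tM.
apply: triple_silent_for => //.
- by rewrite /= u2.1 // u1.1 // ME subrK natrK.
- by case=> // _; rewrite take0.
move=> r st3 rM u3 rE IS; apply: triple_straight => //.
have pE : Num.truncn (reg st3 vp - 1%:R) = r by rewrite rE addrC natrD addKr natrK.
have QEr : Defs.mem st3 aQ (1 + r) = (nth 0%N tau r)%:R.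
  by rewrite u3.2 // u2.2 // QE.
have tauM : (0 < nth 0%N tau r <= M)%N by apply: (@nth_argsort _ g M r.+1).
have FEr : Defs.mem st3 aF (nth 0%N tau r) = (label B (nth 0%N t r))%:R.
  rewrite u3.2 // u2.2 // u1.2 // (nth_map 0%N) ?size_argsort //.
  by case: (nth 0%N tau r) tauM => [//|q] /andP[_ qM]; rewrite FE.
move=> p; rewrite /exec /= pE rE natrK QEr natrK FEr.
rewrite leq_eqVlt => /predU1P[->|pr].
  rewrite add1n eqxx IS // (take_nth 0%N) ?tM // -cats1 count_cat natrD /=.
  by rewrite addn0.
by rewrite add1n ltn_eqF // IS.
Qed.

Lemma triple_strip st :
  ready st -> reg st veps = eps R l -> reg st vs = scale R l ->
  reg st vw = 2 ^+ i -> reg st vj = j%:R -> reg st vk = k%:R ->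
  triple sc process_strip st (fun=> True)
    (\big[cat/[::]]_(0 <= m < (Num.truncn (2 ^+ i / eps R l)).+1)
     \big[cat/[::]]_(m.+1 <= n < (m + Num.truncn (2 / eps R l)).+1)
       [:: T_stat X Y B (in_rect X Y l i j k m n)])
    (64 + 31 * (size s)%:R + (sc (size s))%:R + 16 * 167 * (2 ^+ i * e ^+ 2)).
Proof.
move=> h epsE sE wE jE kE.
apply: (@triple_weaken _ _ _ _ (fun=> True) _ _
  (22 + (20 + ((13 + (size s)%:R * 18)
   + (((sc (size s))%:R + 9 + (size s)%:R * 13)
   + 2 * (2 * 2 ^+ i * e) * (2 * (2 * e) * 167)))))) => //; last by lra.
apply: (triple_seq (Q1 := fun st' => reg st' vla = (strip_left R N l i j)%:R)).
  apply: triple_straight => //; apply: exec_set_index => //; last exact: ready_N h.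
    by rewrite /= jE epsE sE wE (ready_N h).
  by rewrite addr_ge0 // strip_coord_ge0.
move=> st1 u1 laE; have h1 : ready st1 by apply: ready_unchanged u1 h.
apply: (triple_seq (Q1 := fun st' => reg st' vra = (strip_right R N l i k)%:R)).
  apply: triple_straight => //; apply: exec_set_index => //; last exact: ready_N h1.
    by rewrite /= !u1.1 // kE epsE sE wE (ready_N h).
  exact: strip_coord_ge0.
move=> st2 u2 raE; have h2 : ready st2 by apply: ready_unchanged u2 h1.
rewrite -(u2.1 vla) // in laE.
apply: triple_seq (triple_extract h2 laE raE) _ => st3 u3 ex.
have h3 : ready st3 by apply: ready_unchanged u3 h2.
apply: triple_seq (triple_cumulate ex) _ => st4 u4 [t [ts t_sorted SE]].
have h4 : ready st4 by apply: ready_unchanged u4 h3.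
apply: (triple_scan ts t_sorted); split=> //.
- by rewrite u4.1 // u3.1 // u2.1 // u1.1.
- by rewrite u4.1 // u3.1 // u2.1 // u1.1.
- by rewrite u4.1 // (perm_size ts); case: ex.
Qed.

End Strip.
End Stages.

(** * Running time *)

Section Growth.
Variables (R : realType) (N : nat).
Hypothesis N_ge2 : (2 <= N)%N.

Local Notation logN := (ln N%:R : R).

(** From ln (1 + x) <= x at x = -1/2. *)
Lemma ln2_ge_half : 2^-1 <= ln 2 :> R.
Proof.
have := @le_ln1Dx R (- 2^-1); rewrite (_ : 1 + - 2^-1 = 2^-1); last by field.
rewrite lnV ?posrE //; lra.
Qed.

Lemma logN_ge_half : 2^-1 <= logN.
Proof.
apply: le_trans ln2_ge_half _.
by rewrite ler_ln ?posrE ?ltr0n ?ler_nat //; lia.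
Qed.

(** The two reasons for the choice of the last level: the powers 2^l stay below
    N / (2 log N), and there are O(log N) levels. *)
Lemma level_bounds l : (0 < l)%N -> (l <= lmax R N)%N ->
  2 ^+ l * (2 * logN) <= N%:R /\ l%:R <= 2 * logN.
Proof.
case: l => // l _; rewrite /lmax truncn_gt_nat; set r := N%:R / _.
have ln2 := ln2_ge_half; have lN := logN_ge_half.
have N0 : 0 < N%:R :> R by rewrite ltr0n; lia.
have den0 : 0 < 2 * logN by lra.
have r0 : 0 < r by rewrite divr_gt0.
rewrite ler_pdivlMr; last by lra.
move=> h; split.
  rewrite -ler_pdivlMr // -/r -ler_ln ?posrE ?exprn_gt0 //.
  by rewrite lnXn // -[ln 2 *+ _]mulr_natl.
have : ln r <= logN.
  rewrite ler_ln ?posrE // ler_pdivrMr //.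
  by rewrite ler_peMr //; lra.
have : l.+1%:R * 2^-1 <= l.+1%:R * ln 2 :> R by rewrite ler_wpM2l.
lra.
Qed.

End Growth.

Section Time.
Variables (R : realType) (sc : nat -> nat).
Variables (N : nat) (X Y : N.-tuple R) (B : N.-tuple bool).
Hypotheses (N_ge2 : (2 <= N)%N) (uX : uniq X) (uY : uniq Y).
Variable A : R.
Hypothesis A_ge1 : 1 <= A.

Local Notation logN := (ln N%:R : R).

Hypothesis sort_le :
  forall M, (M <= N)%N -> (sc M)%:R <= A * ((M%:R + 1) * logN).

Implicit Types (st : state R).

Local Lemma N_gt0 : (0 < N)%N.
Proof. by apply: ltnW. Qed.

Local Lemma A_ge0 : 0 <= A.
Proof. exact: le_trans ler01 A_ge1. Qed.

Local Notation e l := ((eps R l)^-1).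

(** The first summand accounts for the rectangles of a strip, the second for
    extracting and sorting its locations. *)
Definition strip_time l i : R :=
  16 * 167 * (2 ^+ i * e l ^+ 2 + A * (scale R l * 2 ^+ i * N%:R) * logN).

Lemma strip_time_ge l i : (0 < l)%N -> 1000 <= strip_time l i.
Proof.
move=> l0; have e6 := inv_eps_ge6 R l0.
have lN := logN_ge_half R N_ge2.
have p1 : 1 <= 2 ^+ i :> R by rewrite exprn_ege1 // ler1n.
have u36 : 1 * (6 * 6) <= 2 ^+ i * e l ^+ 2.
  apply: ler_pM => //; first by lra.
  by rewrite expr2; apply: ler_pM.
have v0 : 0 <= A * (scale R l * 2 ^+ i * N%:R) * logN.
  apply: mulr_ge0; last by lra.
  apply: mulr_ge0 A_ge0 _.
  by apply: mulr_ge0 => //; apply: mulr_ge0; rewrite ?scale_ge0 ?exprn_ge0.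
rewrite /strip_time; move: (2 ^+ i * _) (A * _ * _) u36 v0 => u v u36 v0.
lra.
Qed.

(** The strip has at most x + 1 <= 2 x locations, where x = s 2^i N; the bound
    1 <= x is what lets the rounding term be absorbed. *)
Lemma triple_strip_time st l i j k :
  (0 < l)%N -> 1 <= scale R l * 2 ^+ i * N%:R ->
  (k <= j + Num.truncn (e l))%N ->
  ready X Y B st -> reg st veps = eps R l -> reg st vs = scale R l ->
  reg st vw = 2 ^+ i -> reg st vj = j%:R -> reg st vk = k%:R ->
  triple sc process_strip st (fun=> True)
    (\big[cat/[::]]_(0 <= m < (Num.truncn (2 ^+ i / eps R l)).+1)
     \big[cat/[::]]_(m.+1 <= n < (m + Num.truncn (2 / eps R l)).+1)
       [:: T_stat X Y B (in_rect X Y l i j k m n)])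
    (strip_time l i).
Proof.
move=> l0 x1 kj h eE sE wE jE kE.
apply: triple_weaken (triple_strip sc N_gt0 uX uY l0 h eE sE wE jE kE) _ _ => //.
have := size_strip_le X Y B N_gt0 (i := i) l0 erefl kj.
set s := strip _ _ _ _ _ _ _; rewrite /strip_time.
have sN : (size s <= N)%N.
  rewrite size_strip; apply: leq_trans (leq_subr _ _) (index_of_le _ _).
have := sort_le sN; have lN := logN_ge_half R N_ge2.
move: (scale R l * _ * _) x1 => x x1.
move: (2 ^+ i * _) => y hs hx.
have A1 := A_ge1; have AL : 2^-1 <= A * logN by nra.
have : A * (((size s)%:R + 1) * logN) <= 3 * (A * x * logN).
  have : 0 <= (A * logN) * (3 * x - ((size s)%:R + 1)) by apply: mulr_ge0; lra.
  lra.
have : 2^-1 * x <= A * logN * x by rewrite ler_wpM2r //; lra.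
lra.
Qed.

(** This is 9 y e W, where y = e / (s 2^i) and e bound, up to rounding, the numbers
    of iterations of the two loops and W is [strip_time l i]; it does not depend on i. *)
Definition scale_time l : R :=
  9 * (16 * 167) * (2 ^+ l * e l ^+ 4 + A * (e l ^+ 2 * N%:R * logN)).

Lemma triple_scale st l i :
  (0 < l)%N -> (i <= l)%N -> 2 ^+ l <= N%:R :> R ->
  ready X Y B st -> reg st veps = eps R l -> reg st vs = scale R l ->
  reg st vi = i%:R ->
  triple sc process_scale st (fun=> True)
    (\big[cat/[::]]_(0 <= j < (Num.truncn ((eps R l * scale R l * 2 ^+ i)^-1)).+1)
     \big[cat/[::]]_(j.+1 <= k < (j + Num.truncn (e l)).+1)
     \big[cat/[::]]_(0 <= m < (Num.truncn (2 ^+ i / eps R l)).+1)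
     \big[cat/[::]]_(m.+1 <= n < (m + Num.truncn (2 / eps R l)).+1)
       [:: T_stat X Y B (in_rect X Y l i j k m n)])
    (scale_time l).
Proof.
move=> l0 il PN h eE sE iE.
have e6 := inv_eps_ge6 R l0; have W1 := @strip_time_ge l i l0.
have p0 : 0 < 2 ^+ i :> R by rewrite exprn_gt0.
have P0 : 0 < 2 ^+ l :> R by rewrite exprn_gt0.
(* The number of strip positions j, up to rounding. *)
pose y : R := (eps R l * scale R l * 2 ^+ i)^-1.
have yE : y = e l * (2 ^+ l / 2 ^+ i) by rewrite /y invfM invfM /scale invrK mulrA.
have Pp : 1 <= 2 ^+ l / 2 ^+ i :> R.
  by rewrite ler_pdivlMr // mul1r ler_weXn2l // ler1n.
have ye : e l <= y by rewrite yE ler_peMr //; lra.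
have x1 : 1 <= scale R l * 2 ^+ i * N%:R.
  rewrite -mulrA mulrC -mulrA -[leLHS]mul1r ler_pM ?exprn_ege1 ?ler1n //.
  by rewrite /scale ler_pdivlMr // mul1r.
apply: (@triple_weaken _ _ _ _ (fun=> True) _ _
  ((6 + 7 * i%:R) + 2 * (2 * y) * (2 * e l * strip_time l i))) => //.
  apply: (triple_seq (Q1 := fun st' => reg st' vw = 2 ^+ i)).
    by apply: triple_pow2.
  move=> st1 u1 wE; have h1 : ready X Y B st1 by apply: ready_unchanged u1 h.
  rewrite -(u1.1 veps) // in eE; rewrite -(u1.1 vs) // in sE.
  apply: (triple_nested_for (lo := 0%N) (n := (Num.truncn y).+1)) => //.
  - by rewrite /= eE sE wE div1r loop_count_from0 // -/y; lra.
  - have : (Num.truncn y)%:R <= y by rewrite truncn_le; lra.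
    by rewrite -natr1; lra.
  - lra.
  - rewrite /=; nra.
  move=> j st2 _ u2 jE; have h2 : ready X Y B st2 by apply: ready_unchanged u2 h1.
  rewrite -(u2.1 veps) // in eE; rewrite -(u2.1 vs) // in sE.
  rewrite -(u2.1 vw) // in wE.
  apply: (triple_nested_for (lo := j.+1) (n := Num.truncn (e l))) => //.
  - by rewrite /= jE natr1.
  - by rewrite /= jE eE div1r loop_count_after //; lra.
  - by rewrite truncn_le; lra.
  - lra.
  - by rewrite /=; lra.
  move=> k st3 /andP[_ kj] u3 kE.
  have h3 : ready X Y B st3 by apply: ready_unchanged u3 h2.
  by apply: triple_strip_time; rewrite ?(u3.1 veps) ?(u3.1 vs) ?(u3.1 vw) ?(u3.1 vj).
have ie : i%:R <= e l ^+ 2.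
  apply: (@le_trans _ _ l%:R); first by rewrite ler_nat.
  rewrite /eps invfM !invrK exprMn sqr_sqrtr //.
  by rewrite ler_peMr // expr2; lra.
have -> : scale_time l = 9 * (y * e l * strip_time l i).
  rewrite yE /scale_time /strip_time /scale; field.
  by rewrite !gt_eqF // -invr_gt0; lra.
have e2 : 6 * 6 <= e l ^+ 2 by rewrite expr2; apply: ler_pM.
have : e l ^+ 2 * 1000 <= y * e l * strip_time l i.
  apply: ler_pM => //; first by rewrite exprn_ge0 //; lra.
  by rewrite expr2; apply: ler_wpM2r => //; lra.
rewrite (_ : 2 * (2 * y) * _ = 8 * (y * e l * strip_time l i)); last by ring.
move: (y * e l * _) (e l ^+ 2) ie e2 => u v; lra.
Qed.

(** In [scale_time l], the power e^4 is 36 * 36 * l^2 and 2^l * l^2 is at most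
    4 N log^2 N, whereas e^2 is 36 * l <= 72 log N. *)
Definition level_unit : R :=
  9 * (16 * 167) * ((36 * 36 * 4 + 72) * (A * (N%:R * logN ^+ 2))).

Lemma level_unit_ge : 1000 <= level_unit.
Proof.
have lN := logN_ge_half R N_ge2.
have h1 : 2^-1 * 2^-1 <= logN ^+ 2 by rewrite expr2; apply: ler_pM; rewrite // invr_ge0.
have h2 : 1 * (2^-1 * 2^-1) <= N%:R * logN ^+ 2.
  by apply: ler_pM => //; [lra | rewrite ler1n ltnW].
have h3 : 1 * (2^-1 * 2^-1) <= A * (N%:R * logN ^+ 2).
  by apply: ler_pM => //; lra.
rewrite /level_unit; move: (A * _) h3 => u; lra.
Qed.

Lemma scale_time_le l : (0 < l)%N -> (l <= lmax R N)%N ->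
  scale_time l <= level_unit.
Proof.
move=> l0 ll; have [Pl lL] := level_bounds N_ge2 l0 ll.
have lN := logN_ge_half R N_ge2.
have e2 : e l ^+ 2 = 36 * l%:R.
  by rewrite /eps invfM !invrK exprMn sqr_sqrtr //; ring.
have e4 : e l ^+ 4 = 36 * 36 * l%:R ^+ 2 by rewrite (exprM _ 2 2) e2; ring.
rewrite /scale_time /level_unit e4 e2 ler_pM2l; last by lra.
have P0 : 0 <= 2 ^+ l :> R by rewrite exprn_ge0.
move: (2 ^+ l : R) P0 Pl (l%:R : R) (ler0n R l) lL => P P0 Pl x x0 xL.
have N0 : 0 <= N%:R :> R by [].
have A0 := A_ge0; have A1 := A_ge1.
set L := logN in lN xL Pl *; set n : R := N%:R in N0 Pl *.
have h1 : P * x ^+ 2 <= 4 * (n * L ^+ 2).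
  have a1 : x * (P * (2 * L)) <= x * n by apply: ler_wpM2l.
  have a2 : x * n <= 2 * L * n by apply: ler_wpM2r.
  have a3 : 1 * (L * n) <= 2 * L * (L * n).
    by apply: ler_wpM2r; [apply: mulr_ge0; lra | lra].
  have a4 : P * x * x <= P * x * (2 * L).
    by apply: ler_wpM2l => //; apply: mulr_ge0.
  rewrite !expr2; lra.
have h2 : n * L ^+ 2 <= A * (n * L ^+ 2).
  by rewrite ler_peMl // mulr_ge0 // exprn_ge0 //; lra.
have h3 : A * (x * (n * L)) <= A * (2 * (n * L ^+ 2)).
  apply: ler_wpM2l => //; rewrite expr2.
  have : x * (n * L) <= 2 * L * (n * L) by apply: ler_wpM2r => //; apply: mulr_ge0; lra.
  lra.
lra.
Qed.

Lemma triple_level st l :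
  (0 < l)%N -> (l <= lmax R N)%N -> ready X Y B st -> reg st vell = l%:R ->
  triple sc process_level st (fun=> True)
    (\big[cat/[::]]_(0 <= i < l.+1)
     \big[cat/[::]]_(0 <= j < (Num.truncn ((eps R l * scale R l * 2 ^+ i)^-1)).+1)
     \big[cat/[::]]_(j.+1 <= k < (j + Num.truncn (e l)).+1)
     \big[cat/[::]]_(0 <= m < (Num.truncn (2 ^+ i / eps R l)).+1)
     \big[cat/[::]]_(m.+1 <= n < (m + Num.truncn (2 / eps R l)).+1)
       [:: T_stat X Y B (in_rect X Y l i j k m n)])
    (9 * (logN * level_unit)).
Proof.
move=> l0 ll h lE; have [Pl lL] := level_bounds N_ge2 l0 ll.
have lN := logN_ge_half R N_ge2; have U1 := level_unit_ge.
have PN : 2 ^+ l <= N%:R :> R.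
  by apply: le_trans Pl; rewrite ler_peMr ?exprn_ge0 //; lra.
apply: (@triple_weaken _ _ _ _ (fun=> True) _ _
  ((6 + 7 * l%:R) + (4 + (7 + 2 * (4 * logN) * level_unit)))) => //; last first.
  have : 2^-1 * 1000 <= logN * level_unit by apply: ler_pM; rewrite ?invr_ge0.
  have : logN * 1000 <= logN * level_unit by apply: ler_wpM2l => //; lra.
  lra.
apply: (triple_seq (Q1 := fun st' => reg st' vs = 2 ^+ l)).
  exact: triple_pow2.
move=> st1 u1 sE; have h1 : ready X Y B st1 by apply: ready_unchanged u1 h.
rewrite -(u1.1 vell) // in lE.
apply: (triple_seq (Q1 := fun st' => reg st' vs = scale R l)).
  by apply: triple_straight; rewrite //= sE div1r.
move=> st2 u2 {}sE; have h2 : ready X Y B st2 by apply: ready_unchanged u2 h1.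
rewrite -(u2.1 vell) // in lE.
apply: (triple_seq (Q1 := fun st' => reg st' veps = eps R l)).
  by apply: triple_straight; rewrite //= lE div1r.
move=> st3 u3 eE; have h3 : ready X Y B st3 by apply: ready_unchanged u3 h2.
rewrite -(u3.1 vell) // in lE; rewrite -(u3.1 vs) // in sE.
apply: (triple_nested_for (lo := 0%N) (n := l.+1)) => //.
- by rewrite /= lE subr0 natr1 natrK.
- by rewrite -natr1; lra.
- lra.
- by rewrite /=; lra.
move=> i st4 /andP[_ il] u4 iE.
have h4 : ready X Y B st4 by apply: ready_unchanged u4 h3.
apply: triple_weaken (scale_time_le l0 ll); last by [].
by apply: triple_scale; rewrite ?(u4.1 veps) ?(u4.1 vs).
Qed.

(** The integer part can be smaller than 2, when the loop is empty. *)
Lemma loop_count_from3 (x : R) :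
  Num.truncn ((Num.floor x)%:~R - 3%:R + 1 : R) = ((Num.truncn x).+1 - 3)%N.
Proof.
have [x0|x0] := lerP 0 x.
  rewrite floor_truncn //; case: (leqP 2 (Num.truncn x)) => h.
    by rewrite (_ : _ + 1 = ((Num.truncn x).+1 - 3)%:R) ?natrK // natrB // -natr1; ring.
  rewrite (_ : (_ - 3)%N = 0%N); last by lia.
  apply/eqP; rewrite -leqn0 truncn_le_nat.
  by have : (Num.truncn x)%:R <= 1 :> R; [rewrite lern1; lia | lra].
have -> : Num.truncn x = 0%N by apply/truncn0Pn; rewrite -ltNge; lra.
apply/truncn0Pn; rewrite -ltNge.
have : (Num.floor x)%:~R <= x := floor_le x.
lra.
Qed.

(** The first constant comes from the main loop; the other one leaves room for
    counting the labels and sorting by X. *)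
Definition total_time : R :=
  A * (36 * (9 * (16 * 167) * (36 * 36 * 4 + 72)) + 500)
    * (N%:R * logN ^+ 4).

Lemma triple_algorithm :
  triple sc algorithm (init X Y B) (fun=> True) (all_T X Y B) total_time.
Proof.
have lN := logN_ge_half R N_ge2; have U1 := level_unit_ge.
have n2 : 2 <= N%:R :> R by rewrite ler_nat.
rewrite algorithmE; set st0 := init X Y B.
have lab p : (0 < p <= N)%N -> Defs.mem st0 aB p = (label B p)%:R.
  by move=> hp; rewrite /= hp.
apply: (@triple_weaken _ _ _ _ (fun=> True) _ _
  (2 + ((4 + N%:R * (5 + 3)) + (((sc N)%:R + 2)
    + 2 * (2 * logN) * (9 * (logN * level_unit)))))) => //; last first.
  have := sort_le (leqnn N); have A0 := A_ge0; have A1 := A_ge1.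
  rewrite /total_time /level_unit; set L := logN in lN *; set n : R := N%:R in n2 *.
  (* As L >= 1/2, lower powers of L are at most constant multiples of L ^+ 4. *)
  have L2 : 2^-1 * 2^-1 <= L ^+ 2 by rewrite expr2; apply: ler_pM; rewrite // invr_ge0.
  have L3 : L * (2^-1 * 2^-1) <= L ^+ 3 by rewrite exprS; apply: ler_wpM2l => //; lra.
  have L4 : (2^-1 * 2^-1) * (2^-1 * 2^-1) <= L ^+ 4.
    by rewrite (exprM _ 2 2) [leRHS]expr2; apply: ler_pM => //; lra.
  have L4' : L * 2^-1 <= 4 * L ^+ 4.
    have : L * (L * (2^-1 * 2^-1)) <= L * L ^+ 3 by apply: ler_wpM2l => //; lra.
    rewrite -exprS.
    have : 2^-1 * L <= L * L by apply: ler_wpM2r => //; lra.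
    lra.
  have b1 : n * ((2^-1 * 2^-1) * (2^-1 * 2^-1)) <= n * L ^+ 4.
    by apply: ler_wpM2l => //; lra.
  have b2 : n * L ^+ 4 <= A * (n * L ^+ 4).
    by rewrite ler_peMl //; apply: mulr_ge0; lra.
  have b3 : A * ((n + 1) * L) <= A * (16 * (n * L ^+ 4)).
    apply: ler_wpM2l => //.
    have : (n + 1) * L <= 2 * n * L by apply: ler_wpM2r; lra.
    have : n * (L * 2^-1) <= n * (4 * L ^+ 4) by apply: ler_wpM2l => //; lra.
    lra.
  have -> : 2 * (2 * L) * (9 * (L * (9 * (16 * 167) * ((36 * 36 * 4 + 72) *
      (A * (n * L ^+ 2)))))) =
    36 * (9 * (16 * 167) * (36 * 36 * 4 + 72)) * (A * (n * L ^+ 4)) by ring.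
  rewrite (_ : A * _ * _ =
    36 * (9 * (16 * 167) * (36 * 36 * 4 + 72)) * (A * (n * L ^+ 4)) +
    500 * (A * (n * L ^+ 4))); last by ring.
  move: (36 * _ * _) => big; lra.
apply: (triple_seq (Q1 := fun st' => reg st' vK = 0)).
  by apply: triple_straight.
move=> st1 u1 KE.
pose I r (st' : state R) := reg st' vK = (count (label B) (iota 1 r))%:R :> R.
have NE1 : reg st1 vN = N%:R by rewrite u1.1.
apply: (triple_seq (Q1 := I N)).
  apply: (triple_weaken (w := (1 + 1 + 2)%:R + N%:R * (5 + 3))); last by [].
    apply: (triple_silent_for (lo := 1%N) (I := I)) => //.
      by rewrite /= NE1 subrK natrK.
    move=> r st2 rN u2 rE IE; apply: triple_straight => //.
    rewrite /I -[r.+1]addn1 iotaD count_cat natrD -IE add1n.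
    by rewrite /exec /= rE natrK u2.2 // u1.2 // lab // addn0.
  by [].
move=> st2 u2 {}KE; have NE2 : reg st2 vN = N%:R by rewrite u2.1.
apply: (triple_seq (Q1 := ready X Y B)).
  split; rewrite ?cats0 //; last first.
    by rewrite /exec /= NE2 natrK !natrD; lra.
  have aXE : Defs.mem st2 aX = locX X Y B by rewrite u2.2 // u1.2.
  split=> //; rewrite /exec /=.
  - by rewrite u2.2 // u1.2.
  - by move=> p hp; rewrite u2.2 // u1.2 // lab.
  - by move=> p hp; rewrite NE2 natrK hp aXE.
move=> st3 u3 h3.
pose n := ((lmax R N).+1 - 3)%N.
have -> : all_T X Y B = \big[cat/[::]]_(3 <= l < 3 + n)
  \big[cat/[::]]_(0 <= i < l.+1)
  \big[cat/[::]]_(0 <= j < (Num.truncn ((eps R l * scale R l * 2 ^+ i)^-1)).+1)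
  \big[cat/[::]]_(j.+1 <= k < (j + Num.truncn (e l)).+1)
  \big[cat/[::]]_(0 <= m < (Num.truncn (2 ^+ i / eps R l)).+1)
  \big[cat/[::]]_(m.+1 <= n < (m + Num.truncn (2 / eps R l)).+1)
    [:: T_stat X Y B (in_rect X Y l i j k m n)].
  rewrite /n; case: (leqP 3 (lmax R N).+1) => h; first by rewrite subnKC.
  rewrite /all_T big_geq; last exact: ltnW.
  by rewrite big_geq //; lia.
apply: (triple_nested_for (lo := 3%N) (n := n)) => //.
- by rewrite /= (ready_N h3) loop_count_from3.
- have [n0|n0] := posnP n; first by rewrite n0; lra.
  have ll : (0 < lmax R N)%N by move: n0; rewrite /n; lia.
  have [_] := level_bounds N_ge2 ll (leqnn _); apply: le_trans.
  by rewrite ler_nat /n; lia.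
- lra.
- have : 2^-1 * 1000 <= logN * level_unit by apply: ler_pM; rewrite ?invr_ge0.
  by rewrite /=; lra.
move=> l st4 /andP[l3 ln] u4 lE.
have h4 : ready X Y B st4 by apply: ready_unchanged u4 h3.
by apply: triple_level => //; [lia | rewrite /n in ln; lia].
Qed.

End Time.

Theorem proposition1 (R : realType) (sc : nat -> nat)
  (hsc : exists c : R, forall M : nat, (2 <= M)%N ->
           (sc M)%:R <= c * (M%:R * ln M%:R)) :
  exists C : R, forall (N : nat) (X Y : N.-tuple R) (B : N.-tuple bool),
    (2 <= N)%N -> uniq X -> uniq Y ->
    let final := exec sc algorithm (init X Y B) in
    out final = all_T X Y B /\
    (steps final)%:R <= C * (N%:R * ln N%:R ^+ 4).
Proof.
(* The hypothesis says nothing on sorting 0 or 1 numbers, so the constant must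
   also cover these two costs. *)
case: hsc => c hsc; pose A : R := 1 + `|c| + 2 * ((sc 0)%:R + (sc 1)%:R).
have c0 : 0 <= `|c| by [].
have A1 : 1 <= A by rewrite /A; have := ler0n R (sc 0); have := ler0n R (sc 1); lra.
exists (A * (36 * (9 * (16 * 167) * (36 * 36 * 4 + 72)) + 500)).
move=> N X Y B N2 uX uY.
have lN := logN_ge_half R N2.
have small (q : nat) : 2 * q%:R <= A -> q%:R <= A * (1 * ln N%:R).
  move=> qA; have : A * 2^-1 <= A * ln N%:R by apply: ler_wpM2l => //; lra.
  lra.
have sort_le M : (M <= N)%N -> (sc M)%:R <= A * ((M%:R + 1) * ln N%:R).
  case: M => [|[|M]] MN.
  - rewrite add0r; apply: small.
    by rewrite /A; have := ler0n R (sc 1); lra.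
  - apply: (@le_trans _ _ (A * (1 * ln N%:R))).
      by apply: small; rewrite /A; have := ler0n R (sc 0); lra.
    apply: ler_wpM2l; first lra.
    by apply: ler_wpM2r; lra.
  have lM0 : 0 <= ln M.+2%:R :> R by rewrite ln_ge0 // ler1n.
  have lMN : ln M.+2%:R <= ln N%:R :> R.
    by rewrite ler_ln ?posrE ?ltr0n ?ler_nat // ltnW.
  apply: le_trans (hsc M.+2 isT) _.
  apply: (@le_trans _ _ (`|c| * (M.+2%:R * ln M.+2%:R))).
    by apply: ler_wpM2r; [exact: mulr_ge0 | exact: ler_norm].
  apply: ler_pM => //; first exact: mulr_ge0.
    by rewrite /A; have := ler0n R (sc 0); have := ler0n R (sc 1); lra.
  by apply: ler_pM => //; lra.
have [_ outE time] := triple_algorithm B N2 uX uY A1 sort_le.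
by split; [rewrite outE | apply: le_trans time _; rewrite add0r].
Qed.
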